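(* For any type $\sigma$ and any sequence of blocks $\delta=(d_1^{e_1},\ldots,d_s^{e_s})$, \[ m_{\sigma}^{\otimes}P_{\delta} =\sum_{\tau}\left[\sum_{T\in\mathrm{PTBT}(\tau,(\sigma;\delta))} \operatorname{wt}(T)\right] m_{\tau}^{\otimes}, \] where the outer sum is over types $\tau$ and $\mathrm{PTBT}(\tau,(\sigma;\delta))$ is the set of $P$-tensor brick tabloids of shape $\tau$ and extended content $(\sigma;\delta)$.
   Context: An integer partition is a finite (possibly empty) weakly decreasing sequence of positive integers; $\ell(\lambda)$ is its number of parts. A block is an ordered pair of positive integers written $d^m$ (degree $d$, multiplicity $m$). Blocks are ordered by $a^b\ge d^e$ iff $a>d$, or $a=d$ and $b\ge e$. A type is a finite (possibly empty) weakly decreasing sequence of blocks. For $k\ge1$, $\tau|_k$ denotes the integer partition formed by the multiplicities of the blocks of $\tau$ of degree $k$; the type $\tau$ is determined by $(\tau|_k)_{k\ge1}$. The tensor diagram of $\tau$ is the sequence of partition diagrams $\mathrm{dg}(\tau|_1)\otimes\mathrm{dg}(\tau|_2)\otimes\cdots$; the $k$th component has left-justified rows of boxes of lengths the parts of $\tau|_k$. Variables: $x_{k,j}$ for $k,j\ge 1$, with $\deg x_{k,j}=k$; $\mathbf{x}_{k*}=(x_{k,1},x_{k,2},\dots)$. The algebra $\mathsf{P\Lambda}$ of polysymmetric functions consists of the formal series over $\mathbb{Q}$ of bounded degree in all the $x_{k,j}$ that, for each fixed $k$, are unchanged by any permutation of the variables $\mathbf{x}_{k*}$. Define $m^{\otimes}_\tau=\prod_{k\ge1}m_{\tau|_k}(\mathbf{x}_{k*})$,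 where $m_\lambda$ is the monomial symmetric function. Define $P_d=\sum_{k\mid d}k\sum_{j\ge1}x_{k,j}^{d/k}$, let $P_{d^e}$ be obtained from $P_d$ by replacing every variable $x_{k,j}$ by $x_{k,j}^e$, and set $P_\delta=\prod_{i=1}^sP_{d_i^{e_i}}$. A $P$-tensor brick tabloid (PTBT) of shape $\tau$ and extended content $(\sigma;\delta)$ is a covering of the tensor diagram of $\tau$ by labeled horizontal bricks (height $1$, lying within a single row of a component), with labels in $\{0,1,\dots,s\}$, such that: every box is covered by exactly one brick; the brick labels in each row of each component strictly increase from left to right (so each row has at most one brick labeled $0$); for each $k$, the $k$th component contains exactly $\ell(\sigma|_k)$ bricks labeled $0$, whose lengths are the parts of $\sigma|_k$ (bricks with the same label and length are indistinguishable); and for each $1\le i\le s$ exactly one brick labeled $i$ is used, placed in the $k_i$th component for some positive divisor $k_i$ of $d_i$ and having length $d_ie_i/k_i$. The weight $\operatorname{wt}(T)=\prod_{k\ge1}k^{n_k(T)}$, where $n_k(T)$ is the number of positively labeled bricks in component $k$. *)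

(* Defs.v *)
From HB Require Import structures.
From mathcomp Require Import all_boot all_order all_algebra.
From mathcomp Require Import finmap all_classical.
From mathcomp.multinomials Require Import monalg.

Set Implicit Arguments.
Unset Strict Implicit.
Unset Printing Implicit Defensive.

Import GRing.Theory.

Local Open Scope classical_set_scope.
Local Open Scope ring_scope.

(* Infinite sums and products below are finitely supported ones: the notation
   \big[op/idx]_(i \in A) F i iterates op over the i in A with F i <> idx.
   Sums of formal series that are not finite are taken coefficientwise. *)

Record posint := PosInt { nat_of_pos :> nat; pos_gt0 : (0 < nat_of_pos)%N }.
HB.instance Definition _ := [isSub for nat_of_pos].
HB.instance Definition _ := [Countable of posint by <:].

Definition is_part (s : seq posint) : bool :=
  sorted (fun a b : posint => b <= a)%N s.

Record intpart := IntPart { parts :> seq posint; _ : is_part parts }.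
HB.instance Definition _ := [isSub for parts].
HB.instance Definition _ := [Countable of intpart by <:].

(* The block d^m is the pair (d, m). *)
Definition block := (posint * posint)%type.

Definition block_ge (a b : block) : bool :=
  (b.1 < a.1)%N || ((a.1 == b.1) && (b.2 <= a.2)%N).

Record blocktype :=
  BlockType { blocks :> seq block; _ : sorted block_ge blocks }.
HB.instance Definition _ := [isSub for blocks].
HB.instance Definition _ := [Countable of blocktype by <:].

Definition mults (t : blocktype) (k : posint) : seq posint :=
  [seq b.2 | b <- t & b.1 == k].

Fact mults_is_part t k : is_part (mults t k).
Proof.
case: t => s /= ss; rewrite /mults /is_part sorted_map /=.
have tr : transitive block_ge.
  move=> b a c /orP[ba|/andP[/eqP ab bb]] /orP[cb|/andP[/eqP bc cc]].
  - by rewrite /block_ge (ltn_trans cb ba).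
  - by rewrite /block_ge -bc ba.
  - by rewrite /block_ge ab cb.
  - by rewrite /block_ge ab bc eqxx (leq_trans cc bb) orbT.
have := sorted_filter tr (fun b : block => b.1 == k) ss.
have : all (fun b : block => b.1 == k) [seq b <- s | b.1 == k].
  exact: filter_all.
elim: [seq _ <- _ | _] => //= x r IH /andP[/eqP xk ar] pr.
have {}IH := IH ar (path_sorted pr).
case: r ar pr IH => //= y r /andP[/eqP yk _] /andP[+ _] ->.
by rewrite /block_ge xk yk ltnn eqxx /= => ->.
Qed.

Definition restr (t : blocktype) (k : posint) : intpart :=
  IntPart (mults_is_part t k).

(* The variable x_{k,j} is the pair (k, j). *)
Definition var := (posint * posint)%type.
Notation monom := {cmonom var}.

Definition monom_deg (a : monom) : nat :=
  (\sum_(v <- finsupp a) a v * v.1)%N.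

(* A formal series in the x_{k,j} is the family of its coefficients. *)
Record series := Series { coef :> monom -> rat }.
HB.instance Definition _ := [isNew for coef].
HB.instance Definition _ := [Choice of series by <:].

Lemma seriesP (f g : series) : f =1 g -> f = g.
Proof. by case: f g => f [g] /= fg; congr Series; apply/funext. Qed.

Definition series_zero := Series (fun=> 0).
Definition series_opp (f : series) := Series (fun a => - f a).
Definition series_add (f g : series) := Series (fun a => f a + g a).
Definition series_scale (c : rat) (f : series) := Series (fun a => c * f a).

Fact series_addA : associative series_add.
Proof. by move=> f g h; apply: seriesP => a /=; rewrite addrA. Qed.
Fact series_addC : commutative series_add.
Proof. by move=> f g; apply: seriesP => a /=; rewrite addrC. Qed.
Fact series_add0 : left_id series_zero series_add.
Proof. by move=> f; apply: seriesP => a /=; rewrite add0r. Qed.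
Fact series_addN : left_inverse series_zero series_opp series_add.
Proof. by move=> f; apply: seriesP => a /=; rewrite addNr. Qed.
HB.instance Definition _ := GRing.isZmodule.Build series
  series_addA series_addC series_add0 series_addN.

Fact series_scaleA c d f :
  series_scale c (series_scale d f) = series_scale (c * d) f.
Proof. by apply: seriesP => a /=; rewrite mulrA. Qed.
Fact series_scale1 : left_id 1 series_scale.
Proof. by move=> f; apply: seriesP => a /=; rewrite mul1r. Qed.
Fact series_scaleDr : right_distributive series_scale +%R.
Proof. by move=> c f g; apply: seriesP => a /=; rewrite mulrDr. Qed.
Fact series_scaleDl f : {morph series_scale^~ f : c d / c + d}.
Proof. by move=> c d; apply: seriesP => a /=; rewrite mulrDl. Qed.
HB.instance Definition _ := GRing.Zmodule_isLmodule.Build rat series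
  series_scaleA series_scale1 series_scaleDr series_scaleDl.

Definition factorizations (a : monom) : set (monom * monom) :=
  [set p | mmul p.1 p.2 = a].

Definition series_one := Series (fun a => (a == mone)%:R).
(* Cauchy product; every monomial has finitely many factorizations. *)
Definition series_mul (f g : series) :=
  Series (fun a => \sum_(p \in factorizations a) f p.1 * g p.2).

Lemma finite_factorizations a : finite_set (factorizations a).
Proof.
pose S := finsupp a.
pose D : set monom := [set b | forall v, (b v <= a v)%N].
have finD : finite_set D.
  pose F := {ffun S -> 'I_(\max_(v <- S) a v).+1}.
  pose h (f : F) : monom := [cmonom val (f i) | i : S]%M.
  apply: (@sub_finite_set _ _ (h @` [set: F])); last first.
    by apply: finite_image; exact: finite_finset.
  move=> b /= bD.
  exists [ffun v : S => inord (b (val v))] => //.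
  apply/eqP/cmP => v; rewrite /h cmE /=.
  have [vS|vS] := boolP (v \in S).
    rewrite fsfun_ffun insubT /= ffunE /= inordK // ltnS.
    by rewrite (leq_trans (bD v)) // leq_bigmax_seq.
  rewrite fsfun_ffun insubF ?(negbTE vS) //=.
  apply/esym/eqP; rewrite -leqn0 (leq_trans (bD v)) // leqn0.
  by rewrite cmE_eq0.
apply: (@sub_finite_set _ _ (D `*` D)); last exact: finite_setX.
by move=> [b c] /= bc; split=> v /=; rewrite -bc cmM ?leq_addr ?leq_addl.
Qed.

Definition fact_seq (a : monom) : {fset monom * monom} :=
  fset_set (factorizations a).

Lemma mem_fact_seq a p : (p \in fact_seq a) = (mmul p.1 p.2 == a).
Proof.
rewrite in_fset_set; last exact: finite_factorizations.
by apply/idP/eqP; rewrite inE.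
Qed.

Lemma series_mulE f g a :
  series_mul f g a = \sum_(p <- fact_seq a) f p.1 * g p.2.
Proof. by rewrite /= fsbig_finite //; exact: finite_factorizations. Qed.

Fact series_mulC : commutative series_mul.
Proof.
move=> f g; apply: seriesP => a; rewrite !series_mulE.
pose sw (p : monom * monom) := (p.2, p.1).
have swK : involutive sw by case.
rewrite [RHS](_ : _ = \sum_(p <- map sw (fact_seq a)) f p.1 * g p.2).
  apply/perm_big/uniq_perm; rewrite ?map_inj_uniq ?fset_uniq //.
    exact: inv_inj.
  move=> p; rewrite -[p in RHS]swK mem_map; last exact: inv_inj.
  by rewrite !mem_fact_seq /= mulmC.
by rewrite big_map; apply: eq_bigr => p _; rewrite mulrC.
Qed.

Fact series_mul1 : left_id series_one series_mul.
Proof.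
move=> f; apply: seriesP => a; rewrite series_mulE.
rewrite (bigD1_seq (mone, a)) ?fset_uniq ?mem_fact_seq ?mul1m //=.
rewrite /series_one eqxx mul1r big1_seq ?addr0 // => -[b c] /=.
rewrite mem_fact_seq /= => /andP[+ /eqP ea].
case: (b =P mone) => [eb|]; last by rewrite mul0r.
by rewrite -ea eb mul1m eqxx.
Qed.

Fact series_mulDl : left_distributive series_mul +%R.
Proof.
move=> f g h; apply: seriesP => a.
transitivity (series_mul f h a + series_mul g h a); last by [].
by rewrite !series_mulE -big_split; apply: eq_bigr => p _ /=; rewrite mulrDl.
Qed.

Fact series_mulA : associative series_mul.
Proof.
move=> f g h; apply: seriesP => a; rewrite !series_mulE.
pose T := ((monom * monom) * monom)%type.
pose F (t : T) := f t.1.1 * g t.1.2 * h t.2.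
transitivity (\sum_(t <- [seq ((p.1, q.1), q.2) |
    p <- fact_seq a, q <- fact_seq p.2]) F t).
  rewrite big_allpairs_dep; apply: eq_bigr => p _.
  by rewrite series_mulE mulr_sumr; apply: eq_bigr => q _; rewrite mulrA.
transitivity (\sum_(t <- [seq (q, p.2) |
    p <- fact_seq a, q <- fact_seq p.1]) F t); last first.
  rewrite big_allpairs_dep; apply: eq_bigr => p _.
  by rewrite series_mulE mulr_suml; apply: eq_bigr => q _.
apply/perm_big/uniq_perm.
- apply: allpairs_uniq_dep => [|p _|]; [exact: fset_uniq..|].
  move=> [[p1 p2] [q1 q2]] [[r1 r2] [s1 s2]].
  move=> /allpairsPdep[x [y [_ + [-> ->]]]] /allpairsPdep[z [w [_ + [-> ->]]]].
  rewrite !mem_fact_seq /= => /eqP ex /eqP ez [e1 e2 e3].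
  case: x z y w ex ez e1 e2 e3 => [x1 x2] [z1 z2] [y1 y2] [w1 w2] /=.
  by move=> <- <- -> -> ->.
- apply: allpairs_uniq_dep => [|p _|]; [exact: fset_uniq..|].
  move=> [p q] [r s].
  move=> /allpairsPdep[x [y [_ + [-> ->]]]] /allpairsPdep[z [w [_ + [-> ->]]]].
  rewrite !mem_fact_seq /= => /eqP ex /eqP ez [e1 e2].
  case: x z ex ez e2 => [x1 x2] [z1 z2] /=.
  by rewrite e1 => <- <- ->.
move=> t; apply/allpairsPdep/allpairsPdep => -[p [q]].
  rewrite !mem_fact_seq => -[/eqP ep /eqP eq ->].
  exists (mmul p.1 q.1, q.2), (p.1, q.1); rewrite !mem_fact_seq /= eqxx.
  by rewrite -mulmA eq ep eqxx.
rewrite !mem_fact_seq => -[/eqP ep /eqP eq ->].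
exists (q.1, mmul q.2 p.2), (q.2, p.2); rewrite !mem_fact_seq /= eqxx.
by rewrite mulmA eq ep eqxx; split=> //; case: q {eq}.
Qed.

Fact series_one_neq0 : series_one != 0.
Proof.
apply/eqP => /(congr1 (fun f : series => f mone)) /=.
by rewrite eqxx => /eqP; rewrite oner_eq0.
Qed.

HB.instance Definition _ := GRing.Zmodule_isComNzRing.Build series
  series_mulA series_mulC series_mul1 series_mulDl series_one_neq0.

Fact series_scaleAl (c : rat) (f g : series) : c *: (f * g) = c *: f * g.
Proof.
apply: seriesP => a.
transitivity (c * series_mul f g a); first by [].
transitivity (series_mul (c *: f) g a); last by [].
by rewrite !series_mulE mulr_sumr; apply: eq_bigr => p _; rewrite mulrA.
Qed.
HB.instance Definition _ :=
  GRing.Lmodule_isLalgebra.Build rat series series_scaleAl.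
HB.instance Definition _ := GRing.Lalgebra_isComAlgebra.Build rat series.

Definition bounded_degree (f : series) : Prop :=
  exists N, forall a, f a != 0 -> (monom_deg a <= N)%N.

Definition permvar (k : posint) (s : posint -> posint) (v : var) : var :=
  (v.1, if v.1 == k then s v.2 else v.2).

(* [b v = a (permvar k s v)] says that the substitution
   x_{k,j} |-> x_{k, s^-1(j)} turns the monomial a into the monomial b. *)
Definition symmetric_vars (f : series) : Prop :=
  forall (k : posint) (s : posint -> posint), bijective s ->
  forall a b : monom, (forall v, b v = a (permvar k s v)) -> f b = f a.

Definition polysym : {pred series} :=
  fun f => `[< bounded_degree f /\ symmetric_vars f >].

Lemma permvarK k s s' : cancel s s' -> cancel (permvar k s) (permvar k s').
Proof.
by move=> ss' [i j]; rewrite /permvar /=; case: (i =P k) => // _; rewrite ss'.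
Qed.

Lemma monom_comp (h : var -> var) : bijective h ->
  forall a : monom, exists b : monom, forall v, b v = a (h v).
Proof.
case=> h' hK h'K a.
exists [cmonom a (h v) | v in h' @` finsupp a]%M => v.
rewrite cmE fsfun_fun; case: ifPn => // /imfsetP nv.
apply/esym/eqP; rewrite cmE_eq0; apply: contra_notN nv => hv.
by exists (h v); rewrite ?hK.
Qed.

Lemma monom_eqP (a b : monom) : (forall v, a v = b v) -> a = b.
Proof. by move=> ab; apply/eqP/cmP. Qed.

Lemma monom_degEw (a : monom) (S : {fset var}) : (finsupp a `<=` S)%fset ->
  monom_deg a = (\sum_(v <- S) a v * v.1)%N.
Proof.
move=> aS; rewrite /monom_deg (big_fset_incl _ aS) // => v _.
by rewrite -cmE_eq0 => /eqP ->; rewrite mul0n.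
Qed.

Lemma monom_degM (a b : monom) :
  monom_deg (mmul a b) = (monom_deg a + monom_deg b)%N.
Proof.
rewrite (monom_degEw (fsubsetUl (finsupp a) (finsupp b))).
rewrite (monom_degEw (fsubsetUr (finsupp a) (finsupp b))).
rewrite /monom_deg mdomD -big_split /=.
by apply: eq_bigr => v _; rewrite cmM mulnDl.
Qed.

Fact polysym_subalg_closed : GRing.subalg_closed polysym.
Proof.
split=> [|c f g /asboolP[[M fM] fS] /asboolP[[N gN] gS]|
          f g /asboolP[[M fM] fS] /asboolP[[N gN] gS]]; apply/asboolP; split.
- exists 0%N => a; rewrite /GRing.one /=.
  by have [->|] := eqVneq a mone; rewrite ?eqxx // /monom_deg mdom1 big_seq_fset0.
- move=> k s [s' sK s'K] a b ab; rewrite /GRing.one /=; congr (_%:R).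
  congr nat_of_bool; apply/eqP/eqP => e; apply: monom_eqP => v.
    have := ab (permvar k s' v); rewrite e cm1 (permvarK k s'K) => <-.
    by rewrite cm1.
  by rewrite ab e !cm1.
- exists (maxn M N) => a; rewrite leq_max; apply: contraR.
  rewrite negb_or => /andP[Ma Na].
  have /eqP fa : f a == 0 by apply: contraR Ma => /fM.
  have /eqP ga : g a == 0 by apply: contraR Na => /gN.
  by apply/eqP; transitivity (c * f a + g a); rewrite // fa ga mulr0 addr0.
- move=> k s bs a b ab.
  transitivity (c * f b + g b); first by [].
  by rewrite (fS _ _ bs _ _ ab) (gS _ _ bs _ _ ab).
- exists (M + N)%N => a; apply: contraR => degN.
  apply/eqP; transitivity (series_mul f g a); first by [].
  rewrite series_mulE big1_seq // => -[b c]; rewrite mem_fact_seq /= => /eqP e.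
  have [->|/fM fb] := eqVneq (f b) 0; first by rewrite mul0r.
  have [->|/gN gc] := eqVneq (g c) 0; first by rewrite mulr0.
  by rewrite -e monom_degM leq_add in degN.
move=> k s bs a b ab.
transitivity (series_mul f g b); first by [].
transitivity (series_mul f g a); last by [].
have [s' sK s'K] := bs.
have bh : bijective (permvar k s).
  by exists (permvar k s'); exact: permvarK.
have [c cE] := choice (monom_comp bh).
have c_inj : injective c.
  move=> x y /(congr1 (fun z : monom => fun v => z v)) exy.
  apply: monom_eqP => v.
  have /= := congr1 (@^~ (permvar k s' v)) exy.
  by rewrite !cE (permvarK k s'K).
have cM x y : c (mmul x y) = mmul (c x) (c y).
  by apply: monom_eqP => v; rewrite cE !cmM !cE.
have c_surj y : exists x, c x = y.
  have bh' : bijective (permvar k s').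
    by exists (permvar k s); exact: permvarK.
  have [x xE] := monom_comp bh' y.
  by exists x; apply: monom_eqP => v; rewrite cE xE permvarK.
have -> : b = c a by apply: monom_eqP => v; rewrite ab cE.
rewrite !series_mulE.
pose cc (p : monom * monom) := (c p.1, c p.2).
have cc_inj : injective cc by move=> [? ?] [? ?] [/c_inj-> /c_inj->].
rewrite [LHS](_ : _ = \sum_(p <- map cc (fact_seq a)) f p.1 * g p.2).
  rewrite big_map; apply: eq_bigr => -[x y] _ /=.
  by rewrite (fS _ _ bs _ _ (cE x)) (gS _ _ bs _ _ (cE y)).
apply/perm_big/uniq_perm; rewrite ?map_inj_uniq ?fset_uniq //.
move=> [y z]; have [x <-] := c_surj y; have [w <-] := c_surj z.
rewrite -[(c x, c w)]/(cc (x, w)) mem_map // !mem_fact_seq /= -cM.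
by rewrite (inj_eq c_inj).
Qed.
HB.instance Definition _ :=
  GRing.isSubalgClosed.Build rat series polysym polysym_subalg_closed.

(* The algebra of polysymmetric functions *)
Record plam := PLam { plam_series :> series; plamP : plam_series \in polysym }.
HB.instance Definition _ := [isSub for plam_series].
HB.instance Definition _ := [Choice of plam by <:].
HB.instance Definition _ := [SubChoice_isSubComNzRing of plam by <:].
HB.instance Definition _ := [SubZmodule_isSubLmodule of plam by <:].
HB.instance Definition _ := [SubNzRing_SubLmodule_isSubLalgebra of plam by <:].
HB.instance Definition _ := [SubLalgebra_isSubAlgebra of plam by <:].

Definition xvar (k j : posint) : monom := ucm (k, j).

Lemma expcmnS (a : monom) n : expcmn a n.+1 = mmul a (expcmn a n).
Proof. by case: n => [|n] //=; rewrite /expcmn /= mulm1. Qed.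

Lemma expcmnE (a : monom) n v : expcmn a n v = (n * a v)%N.
Proof.
by elim: n => [|n IH]; [rewrite cm1 | rewrite expcmnS cmM IH mulSn].
Qed.

Lemma monom_deg1 : monom_deg mone = 0%N.
Proof. by rewrite /monom_deg mdom1 big_seq_fset0. Qed.

Lemma monom_deg_exp (a : monom) n : monom_deg (expcmn a n) = (n * monom_deg a)%N.
Proof.
elim: n => [|n IH]; first exact: monom_deg1.
by rewrite expcmnS monom_degM IH mulSn.
Qed.

Lemma monom_deg_xvar k j : monom_deg (xvar k j) = k.
Proof. by rewrite /monom_deg mdomU big_seq_fset1 /= ucmE eqxx mul1n. Qed.

Lemma monom_prodE n (F : 'I_n -> monom) v :
  (\big[mmul/mone]_(i < n) F i) v = (\sum_(i < n) F i v)%N.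
Proof.
by apply: (big_morph (fun a : monom => a v)) => [a b|]; rewrite ?cmM ?cm1.
Qed.

Lemma monom_deg_prod n (F : 'I_n -> monom) :
  monom_deg (\big[mmul/mone]_(i < n) F i) = (\sum_(i < n) monom_deg (F i))%N.
Proof. exact: (big_morph _ monom_degM monom_deg1). Qed.

Lemma xvar_perm k s s' i j v : cancel s s' -> cancel s' s ->
  xvar i j (permvar k s v) = xvar i (permvar k s' (i, j)).2 v.
Proof.
move=> sK s'K; rewrite !ucmE; congr nat_of_bool; case: v => v1 v2.
rewrite /permvar /= ![(_, _) == _]xpair_eqE /=.
case: (i =P v1) => [<-|] //=; case: (i =P k) => // _.
by rewrite -(can_eq s'K) sK.
Qed.

(* The monomials x_{k,j_1}^{l_1} ... x_{k,j_r}^{l_r}, where l_1, ..., l_r are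
   the parts of l and j_1, ..., j_r are distinct; m_l(x_{k*}) is the sum of
   these monomials, each of them counted once. *)
Definition msym_monoms (l : intpart) (k : posint) : set monom :=
  [set a | exists2 j : 'I_(size l) -> posint, injective j &
     a = \big[mmul/mone]_(i < size l) expcmn (xvar k (j i)) (tnth (in_tuple l) i)].

Definition msym_series (l : intpart) (k : posint) :=
  Series (fun a => (a \in msym_monoms l k)%:R).

Fact msym_polysym l k : msym_series l k \in polysym.
Proof.
apply/asboolP; split.
  exists (\sum_(i < size l) tnth (in_tuple l) i * k)%N => a /=.
  have [/set_mem[j _ ->] _|_] := boolP (a \in msym_monoms l k); last first.
    by rewrite eqxx.
  rewrite monom_deg_prod leq_sum // => i _.
  by rewrite monom_deg_exp monom_deg_xvar.
have dir k' s (a b : monom) : bijective s ->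
    (forall v, b v = a (permvar k' s v)) ->
    msym_monoms l k a -> msym_monoms l k b.
  move=> [s' sK s'K] ab [j j_inj ea].
  exists (fun i => (permvar k' s' (k, j i)).2).
    move=> i i' /=; case: ifP => _; first by move/(can_inj s'K)/j_inj.
    exact: j_inj.
  apply: monom_eqP => v; rewrite ab ea !monom_prodE; apply: eq_bigr => i _.
  by rewrite !expcmnE (xvar_perm _ _ _ _ sK s'K).
move=> k' s bs a b ab /=; congr (_%:R); congr nat_of_bool.
apply/idP/idP; rewrite !inE; last exact: dir ab.
have [s' sK s'K] := bs; apply: (dir k' s'); first by exists s.
by move=> v; rewrite ab (permvarK k' s'K).
Qed.

Definition msym (l : intpart) (k : posint) : plam := PLam (msym_polysym l k).

Definition mtensor (t : blocktype) : plam :=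
  \big[*%R/1]_(k \in [set: posint]) msym (restr t k) k.

(* sum_{j >= 1} x_{k,j}^n *)
Definition powersum_series (n : nat) (k : posint) :=
  Series (fun a =>
    \sum_(j \in [set: posint]) ((a == expcmn (xvar k j) n)%:R : rat)).

Fact powersum_polysym n k : powersum_series n k \in polysym.
Proof.
apply/asboolP; split.
  exists (n * k)%N => a /=.
  move/(@fsbigN1 _ _ _ _ _ _
    (fun a j => (a == expcmn (xvar k j) n)%:R : rat))=> [j _].
  have [->|_] := eqVneq a (expcmn (xvar k j) n); last by rewrite eqxx.
  by rewrite monom_deg_exp monom_deg_xvar.
move=> k' s [s' sK s'K] a b ab /=.
pose h j := (permvar k' s' (k, j)).2.
have bh : bijective h.
  by exists (fun j => (permvar k' s (k, j)).2) => j;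
    rewrite /h /permvar /=; case: (k == k') => //; rewrite ?sK ?s'K.
rewrite (reindex_fsbigT h) //; apply: eq_fsbigr => j _.
congr (_%:R); congr nat_of_bool.
have hE v : expcmn (xvar k (h j)) n v = expcmn (xvar k j) n (permvar k' s v).
  by rewrite !expcmnE (xvar_perm _ _ _ _ sK s'K).
apply/eqP/eqP => e; apply: monom_eqP => v; last by rewrite ab e hE.
by rewrite -[v](permvarK k' s'K) -ab e hE.
Qed.

Definition powersum (n : nat) (k : posint) : plam :=
  PLam (powersum_polysym n k).

Definition Pdeg (d : posint) : plam :=
  \sum_(k \in [set k : posint | (k %| d)%N]) k%:R *: powersum (d %/ k) k.

(* Substitution of x_{k,j}^e for every variable x_{k,j} *)
Definition subst_series (e : posint) (f : series) :=
  Series (fun a => \sum_(b \in [set b | expcmn b e = a]) f b).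

Fact subst_polysym e (f : plam) : subst_series e f \in polysym.
Proof.
case: f => f /= /asboolP[[N fN] fS]; apply/asboolP; split.
  exists (e * N)%N => a /=.
  move/(@fsbigN1 _ _ _ _ _ _ (fun _ : unit => coef f) tt)=> [b /= <- /fN bN].
  by rewrite monom_deg_exp leq_mul2l bN orbT.
move=> k s bs a b ab /=; have [s' sK s'K] := bs.
have bh : bijective (permvar k s).
  by exists (permvar k s'); exact: permvarK.
have bh' : bijective (permvar k s').
  by exists (permvar k s); exact: permvarK.
have [c cE] := choice (monom_comp bh).
have [c' c'E] := choice (monom_comp bh').
have cK : cancel c c'.
  by move=> x; apply: monom_eqP => v; rewrite c'E cE (permvarK k s'K).
have c'K : cancel c' c.
  by move=> x; apply: monom_eqP => v; rewrite cE c'E (permvarK k sK).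
have cX x : c (expcmn x e) = expcmn (c x) e.
  by apply: monom_eqP => v; rewrite cE !expcmnE cE.
have eb : b = c a by apply: monom_eqP => v; rewrite ab cE.
rewrite (@reindex_fsbig _ _ _ _ _ c [set x | expcmn x e = a]).
  by apply: eq_fsbigr => x _; rewrite (fS _ _ bs _ _ (cE x)).
split=> [x /= xa|x y _ _|y /= ye]; first by rewrite eb -xa cX.
  exact: (can_inj cK).
exists (c' y); rewrite ?c'K //=.
by apply: (can_inj cK); rewrite cX c'K ye.
Qed.

Definition psubst (e : posint) (f : plam) : plam := PLam (subst_polysym e f).

Definition Pblock (b : block) : plam := psubst b.2 (Pdeg b.1).

Definition Pseq (delta : seq block) : plam := \prod_(b <- delta) Pblock b.

Definition rowlen (t : blocktype) (k : posint) (r : nat) : nat :=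
  nth 0%N [seq (n : nat) | n : posint <- restr t k] r.

(* Box (k, r, c) is in component k, row r and column c; rows and columns are
   numbered from 0. *)
Definition box := (posint * nat * nat)%type.

Definition tensor_diagram (t : blocktype) : set box :=
  [set x | (x.2 < rowlen t x.1.1 x.1.2)%N].

(* A brick placed in component [bcomp] and row [brow], covering the columns
   [bcol], ..., [bcol + blen - 1], with a label in {0, ..., s} *)
Record brick (s : nat) := Brick
  { bcomp : posint; brow : nat; bcol : nat; blen : posint; blabel : 'I_s.+1 }.

Definition brick_tuple s (b : brick s) :=
  (bcomp b, brow b, bcol b, blen b, blabel b).
Definition tuple_brick s (x : posint * nat * nat * posint * 'I_s.+1) :=
  let: (k, r, c, l, i) := x in Brick k r c l i.
Fact brick_tupleK s : cancel (@brick_tuple s) (@tuple_brick s).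
Proof. by case. Qed.
HB.instance Definition _ s :=
  Countable.copy (brick s) (can_type (@brick_tupleK s)).

Definition brick_boxes s (b : brick s) : set box :=
  [set x | [/\ x.1.1 = bcomp b, x.1.2 = brow b & (bcol b <= x.2 < bcol b + blen b)%N]].

(* The i-th block of delta is [tnth (in_tuple delta) i] with i numbered from 0,
   so that the label of its brick is [lift ord0 i], whose value is i.+1. *)
Definition PTBT (t sigma : blocktype) (delta : seq block) :
    set {fset brick (size delta)} :=
  [set T : {fset brick (size delta)} |
    [/\ forall b, b \in T -> brick_boxes b `<=` tensor_diagram t,
        forall x, tensor_diagram t x -> exists! b, b \in T /\ brick_boxes b x,
        forall b c, b \in T -> c \in T -> bcomp b = bcomp c -> brow b = brow c ->
          (bcol b < bcol c)%N -> (blabel b < blabel c)%N,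
        forall k, perm_eq
          [seq blen b | b <- T & (bcomp b == k) && (blabel b == ord0)]
          (restr sigma k) &
        forall i : 'I_(size delta), exists b : brick (size delta),
          [/\ forall c, (c \in T) && (blabel c == lift ord0 i) = (c == b),
              (bcomp b %| (tnth (in_tuple delta) i).1)%N &
              blen b = ((tnth (in_tuple delta) i).1 *
                       (tnth (in_tuple delta) i).2 %/ bcomp b)%N :> nat]]].
Arguments PTBT t sigma delta : clear implicits.

Definition nposbricks s (T : {fset brick s}) (k : posint) : nat :=
  #|` [fset b in T | (bcomp b == k) && (blabel b != ord0)]%fset|.

Definition wt s (T : {fset brick s}) : rat :=
  \big[*%R/1]_(k \in [set: posint]) (k%:R : rat) ^+ nposbricks T k.

(* Main.v *)
Require Import Defs.
From mathcomp Require Import all_boot all_order all_algebra.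
From mathcomp Require Import finmap all_classical.
From mathcomp.multinomials Require Import monalg.
From mathcomp Require Import zify.

(** Both sides are polysymmetric, so they agree as soon as they agree on one
    monomial of each type.  For a type [tau] the natural choice is
    [canon_monom tau], in which the exponent of x_{k,r+1} is the length of row
    r of component k of the diagram of [tau]: variables of this monomial are
    rows of the diagram.  The coefficient of m_tau in any polysymmetric f is
    then the coefficient of [canon_monom tau] in f ([plam_expansion]), and what
    remains is to compute that coefficient for the product m_sigma P_delta.

    Expanding the product, a contribution to a monomial a chooses a monomial b
    of m_sigma and, for each block d^e of delta, a term k x_{k,j}^{de/k} of
    P_{d^e}, such that the product of b and these powers is a.  Since b is
    determined by the other choices, the contributions are indexed by the maps
    f from block indices to variables of a ([is_filling]), and f contributes
    the product of its values k ([coef_mtensor_Pseq]).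

    For a = [canon_monom tau] such a map says in which row the brick of each
    positive label lies; what is left of a row is filled by its brick labeled
    0, if any, and the lengths left over must form a monomial of type sigma.
    Because labels increase along rows, a tabloid carries no other information:
    it amounts to the function giving, for each row and each label, the length
    of the brick with this label in this row, or 0 ([encodes]).  Reading
    tabloids in this way makes f into a tabloid bijectively ([filling_bij]),
    and the weights agree ([wt_placed]). *)

Set Implicit Arguments.
Unset Strict Implicit.
Unset Printing Implicit Defensive.

Import GRing.Theory.

Local Open Scope classical_set_scope.
Local Open Scope ring_scope.

(** * Exponents and types of monomials *)

Definition posS (n : nat) : posint := PosInt (ltn0Sn n).

Lemma posS_pred (p : posint) : posS p.-1 = p.
Proof. by apply: val_inj; rewrite /= prednK // pos_gt0. Qed.

Lemma posS_inj : injective posS.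
Proof. by move=> m n [->]. Qed.

Lemma pos_neq0 (p : posint) : (p : nat) != 0%N.
Proof. by rewrite -lt0n pos_gt0. Qed.

Definition indices (k : posint) (a : monom) : seq posint :=
  [seq v.2 | v <- finsupp a & v.1 == k].

Definition exponents (k : posint) (a : monom) : seq nat :=
  [seq a (k, j) | j <- indices k a].

Lemma mem_indices k a j : (j \in indices k a) = (a (k, j) != 0%N).
Proof.
rewrite cmE_neq0; apply/mapP/idP => [[[k' j']]|kj].
  by rewrite mem_filter /= => /andP[/eqP-> +] ->.
by exists (k, j); rewrite // mem_filter eqxx.
Qed.

Lemma indices_uniq k a : uniq (indices k a).
Proof.
rewrite map_inj_in_uniq ?filter_uniq ?fset_uniq // => -[k1 j1] [k2 j2].
by rewrite !mem_filter /= => /andP[/eqP-> _] /andP[/eqP-> _] ->.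
Qed.

(** The exponents can be read off along any duplicate-free list of indices that
    is large enough, at the price of dropping zeros; this is how lists given by
    rows of a diagram are compared with lists given by supports. *)
Lemma perm_exponents k (a : monom) (s : seq posint) :
  uniq s -> (forall j, a (k, j) != 0%N -> j \in s) ->
  perm_eq (exponents k a) [seq n <- [seq a (k, j) | j <- s] | n != 0%N].
Proof.
move=> us sP; rewrite filter_map; apply/perm_map/uniq_perm.
- exact: indices_uniq.
- exact: filter_uniq.
move=> j; rewrite mem_indices mem_filter /=.
by apply/idP/andP => [aj|[]//]; split=> //; exact: sP.
Qed.

Lemma eq_exponents k (a b : monom) :
  (forall j, a (k, j) = b (k, j)) -> perm_eq (exponents k a) (exponents k b).
Proof.
move=> ab; have -> : exponents k b = [seq a (k, j) | j <- indices k b].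
  by apply: eq_map => j; rewrite ab.
apply/perm_map/uniq_perm; rewrite ?indices_uniq // => j.
by rewrite !mem_indices ab.
Qed.

Definition rows (t : blocktype) (k : posint) : seq nat :=
  [seq (n : nat) | n : posint <- restr t k].

Definition has_type (a : monom) (t : blocktype) : Prop :=
  forall k, perm_eq (exponents k a) (rows t k).

Lemma count_blocks (t : blocktype) (b : block) :
  count_mem b t = count_mem (b.2 : nat) (rows t b.1).
Proof.
rewrite /rows /restr /= /mults !count_map count_filter.
apply: eq_count => -[d m] /=; case: b => d' m' /=.
by rewrite xpair_eqE andbC.
Qed.

Lemma block_ge_trans : transitive block_ge.
Proof.
move=> b a c /orP[ba|/andP[/eqP ab bb]] /orP[cb|/andP[/eqP bc cc]].
- by rewrite /block_ge (ltn_trans cb ba).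
- by rewrite /block_ge -bc ba.
- by rewrite /block_ge ab cb.
- by rewrite /block_ge ab bc eqxx (leq_trans cc bb) orbT.
Qed.

Lemma block_ge_anti : antisymmetric block_ge.
Proof.
move=> [d m] [d' m']; rewrite /block_ge /= => /andP[/orP[lt1|/andP[/eqP e1 le1]]].
  rewrite [(d < d')%N]ltnNge (ltnW lt1) /= => /andP[/eqP e].
  by rewrite e ltnn in lt1.
rewrite e1 ltnn eqxx /= => le2; congr (_, _); apply: val_inj.
by apply/eqP; rewrite eqn_leq; apply/andP.
Qed.

Lemma block_ge_total : total block_ge.
Proof.
move=> [d m] [d' m']; rewrite /block_ge /=.
case: (ltngtP d d') => //= e; rewrite ?orbT //.
by rewrite (val_inj e : d = d') eqxx /= leq_total.
Qed.

(** The multiplicity of d^m in a type is the number of rows of length m in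
    component d, and a sorted list is determined by its multiplicities. *)
Lemma eq_type (t t' : blocktype) :
  (forall k, perm_eq (rows t k) (rows t' k)) -> t = t'.
Proof.
move=> tt'; apply: val_inj => /=.
apply: (sorted_eq block_ge_trans block_ge_anti); rewrite ?(valP t) ?(valP t') //.
by apply/allP => b _ /=; rewrite !count_blocks (permP (tt' _)).
Qed.

Lemma has_type_inj a t t' : has_type a t -> has_type a t' -> t = t'.
Proof.
move=> at1 at2; apply: eq_type => k.
by rewrite -(permPl (at1 k)) at2.
Qed.

(** The blocks are the pairs d^m, one for each variable x_{d,j} of a with
    exponent m. *)
Lemma has_type_exists a : exists t, has_type a t.
Proof.
pose s := [seq (v.1, posS (a v).-1) | v <- finsupp a].
have ss : sorted block_ge (sort block_ge s) by apply: sort_sorted block_ge_total _.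
exists (BlockType ss) => k.
rewrite perm_sym /rows /= /mults.
apply: (perm_trans (perm_map _ (perm_map _ (perm_filter _ _)))).
  exact: permEl (perm_sort _ s).
rewrite filter_map /exponents /indices -!map_comp.
rewrite (_ : map _ _ = [seq a (k, v.2) | v <- finsupp a & v.1 == k]) //.
apply/eq_in_map => v; rewrite mem_filter => /andP[/eqP <- va] /=.
by rewrite -surjective_pairing prednK // lt0n cmE_neq0.
Qed.

Lemma rowlen_neq0 t k r : (rowlen t k r != 0%N) = (r < size (rows t k))%N.
Proof.
have [rs|rs] := ltnP r (size (rows t k)); last by rewrite /rowlen nth_default.
rewrite size_map in rs; rewrite /rowlen (nth_map (posS 0)) //.
exact: pos_neq0.
Qed.

(** The r-th row of component k gives the exponent of x_{k,r+1}; the index set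
    is any finite set that contains all rows. *)
Definition canon_monom (t : blocktype) : monom :=
  [cmonom rowlen t v.1 (v.2 : posint).-1
    | v in [fset (b.1, posS r) | b in blocks t, r in iota 0 (size t)]%fset]%M.

Lemma canon_monomE t k j : canon_monom t (k, j) = rowlen t k j.-1.
Proof.
rewrite cmE fsfun_fun; case: ifPn => //= nS; apply/esym/eqP.
apply: contraNT nS; rewrite rowlen_neq0 /rows size_map => js.
have : has (fun b : block => b.1 == k) t.
  by rewrite has_filter -size_eq0 -(size_map snd) -lt0n (leq_ltn_trans _ js).
case/hasP => b bt /eqP bk; apply/imfset2P; exists b; rewrite //.
exists j.-1; last by rewrite bk posS_pred.
rewrite /= mem_iota add0n (leq_trans js) //.
by rewrite /= size_map size_filter count_size.
Qed.

Lemma canon_monom_has_type t : has_type (canon_monom t) t.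
Proof.
move=> k; apply: perm_trans
  (perm_exponents (s := [seq posS r | r <- iota 0 (size (rows t k))]) _ _) _.
- by rewrite map_inj_uniq ?iota_uniq //; exact: posS_inj.
- move=> j; rewrite canon_monomE rowlen_neq0 => js; apply/mapP; exists j.-1 => //.
    by rewrite mem_iota.
  by rewrite posS_pred.
rewrite -map_comp (eq_map (g := rowlen t k)); last first.
  by move=> r /=; rewrite canon_monomE.
rewrite (_ : [seq _ | r <- _] = rows t k); last exact: mkseq_nth.
rewrite (@eq_in_filter _ _ predT) ?filter_predT //.
by move=> n /mapP[p _ ->]; rewrite /= pos_neq0.
Qed.

Lemma canon_monom_inj : injective canon_monom.
Proof.
move=> t t' e; apply: (has_type_inj (canon_monom_has_type t)).
by rewrite e; exact: canon_monom_has_type.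
Qed.

(** * Invariance under permutations of the variables *)

Lemma perm_map_lift (T U : eqType) (f : T -> U) (s : seq T) (t : seq U) :
  perm_eq (map f s) t -> exists2 s', perm_eq s s' & t = map f s'.
Proof.
case: s => [|x s]; first by rewrite perm_sym => /perm_nilP->; exists [::].
rewrite perm_sym => /(perm_iotaP (f x))[Is pI ->].
exists [seq nth x (x :: s) i | i <- Is]; last first.
  rewrite -map_comp; apply/eq_in_map => i.
  rewrite (perm_mem pI) mem_iota => /andP[_]; rewrite add0n => iI.
  by rewrite (nth_map x) // -(size_map f).
rewrite size_map in pI.
by rewrite perm_sym (perm_trans (perm_map _ pI)) // -/(mkseq _ _) mkseq_nth.
Qed.

(** A partial matching of finite lists extends to a permutation of the whole
    type: matching one more pair costs a composition with a transposition. *)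
Lemma uniq_bij_map (T : eqType) (s t : seq T) : uniq s -> uniq t ->
  size s = size t -> exists2 h : T -> T, bijective h & map h s = t.
Proof.
elim: s t => [|x s IH] [|y t] //=; first by exists id => //; exists id.
move=> /andP[xs us] /andP[yt ut] [/(IH _ us ut)[h [h' hK h'K] hs]].
pose sw z := if z == h x then y else if z == y then h x else z.
have swK : involutive sw.
  move=> z; rewrite /sw; case: (eqVneq z (h x)) => [->|zx].
    by rewrite eqxx; case: eqVneq.
  by case: (eqVneq z y) => [->|zy]; rewrite ?eqxx // (negbTE zx) (negbTE zy).
exists (sw \o h).
  by exists (h' \o sw) => z /=; rewrite ?swK ?hK ?h'K ?swK.
rewrite /= {1}/sw eqxx; congr cons; rewrite map_comp hs -[RHS]map_id.
apply/eq_in_map => z zt; rewrite /sw.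
case: eqVneq => [e|_]; last first.
  by case: eqVneq => [e|//]; rewrite -e zt in yt.
by move: zt; rewrite e -hs mem_map ?(negbTE xs) //; exact: can_inj hK.
Qed.

(** Monomials of the same type are related by permuting the variables of one
    alphabet after the other; the induction is on a list of the alphabets where
    the two monomials may still differ. *)
Lemma polysym_coef_eq (f : series) (a b : monom) : f \in polysym ->
  (forall k, perm_eq (exponents k a) (exponents k b)) -> f a = f b.
Proof.
move=> /asboolP[_ fS] ab.
pose L := [seq v.1 | v <- finsupp (mmul a b)].
have : forall k j, k \notin L -> a (k, j) = b (k, j).
  move=> k j kL; have : (mmul a b) (k, j) == 0%N.
    by rewrite cmE_eq0; apply: contra kL => kj; apply/mapP; exists (k, j).
  by rewrite cmM addn_eq0 => /andP[/eqP-> /eqP->].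
move: L => L; elim: L b ab => [|k L IH] b ab eqL.
  by congr (f _); apply: monom_eqP => -[k j]; exact: eqL.
have /perm_map_lift[s' s's abs'] : perm_eq (exponents k b) (exponents k a).
  by rewrite perm_sym.
have us' : uniq s' by rewrite -(perm_uniq s's) indices_uniq.
have szs : size (indices k a) = size s'.
  by move/(congr1 size): abs'; rewrite !size_map.
(* h moves the indices of a to those of b with the same exponents. *)
have [h [h' hK h'K] hs] := uniq_bij_map (indices_uniq k a) us' szs.
have bh : bijective (permvar k h).
  by exists (permvar k h'); exact: permvarK.
have [c cE] := monom_comp bh b.
have ck j : c (k, j) = a (k, j).
  rewrite cE /permvar /= eqxx; have [ja|ja] := boolP (j \in indices k a).
    move: abs'; rewrite -hs -map_comp /exponents.
    by move/eq_in_map => /(_ j ja) /= ->.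
  transitivity 0%N; last by apply/esym/eqP; rewrite mem_indices negbK in ja.
  apply/eqP; move: ja; apply: contraNT; rewrite -mem_indices (perm_mem s's) -hs.
  by rewrite mem_map //; exact: can_inj hK.
have ck' k' j : k' != k -> c (k', j) = b (k', j).
  by move=> /negbTE nk; rewrite cE /permvar /= nk.
rewrite -(fS k h _ b c cE); last by exists h'.
apply: IH => [k'|k' j k'L].
  have [->|nk] := eqVneq k' k; first by apply: eq_exponents => j; rewrite ck.
  by rewrite (perm_trans (ab k')) //; apply: eq_exponents => j; rewrite ck'.
have [->|nk] := eqVneq k' k; first by rewrite ck.
by rewrite ck' //; apply: eqL; rewrite inE negb_or nk.
Qed.

(** * Finiteness of the set of types of bounded degree *)

Lemma le_monom_deg (a : monom) v : (a v <= monom_deg a)%N.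
Proof.
have [->//|va] := eqVneq (a v) 0%N; rewrite cmE_neq0 in va.
rewrite /monom_deg (big_fsetD1 v) //= (leq_trans _ (leq_addr _ _)) //.
by rewrite leq_pmulr ?pos_gt0.
Qed.

Lemma alphabet_le_deg (a : monom) v : a v != 0%N -> (v.1 <= monom_deg a)%N.
Proof.
move=> v0; have va := v0; rewrite cmE_neq0 in va.
rewrite /monom_deg (big_fsetD1 v) //= (leq_trans _ (leq_addr _ _)) //.
by rewrite leq_pmull ?lt0n.
Qed.

(** With x_{k,j} also x_{k,1}, ..., x_{k,j-1} occur in a canonical monomial,
    so its degree is at least j. *)
Lemma index_le_deg t k j :
  canon_monom t (k, j) != 0%N -> (j <= monom_deg (canon_monom t))%N.
Proof.
move=> kj; pose s := [seq (k, posS r) | r <- iota 0 j].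
have us : uniq s.
  by rewrite map_inj_uniq ?iota_uniq // => r r' [/= ->].
have ss v : v \in s -> v \in finsupp (canon_monom t).
  case/mapP => r; rewrite mem_iota add0n => /andP[_ rj] ->.
  rewrite -cmE_neq0 canon_monomE rowlen_neq0 /=.
  move: kj; rewrite canon_monomE rowlen_neq0; apply: leq_trans.
  by rewrite prednK ?pos_gt0.
have := uniq_leq_size us ss; rewrite size_map size_iota => /leq_trans; apply.
rewrite /monom_deg -sum1_size big_seq [leqRHS]big_seq leq_sum // => v.
by rewrite -cmE_neq0 => v0; rewrite muln_gt0 lt0n v0 pos_gt0.
Qed.

(** The canonical monomials of degree at most N all divide one monomial, which
    has finitely many factorizations. *)
Lemma finite_types N : finite_set [set t | (monom_deg (canon_monom t) <= N)%N].
Proof.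
pose X := [fset v in [seq (posS i, posS j) | i <- iota 0 N, j <- iota 0 N]]%fset.
(* Every type of degree at most N has its canonical monomial dividing A. *)
pose A : monom := [cmonom N | v in X]%M.
have finA := finite_factorizations A.
apply: (@sub_finite_set _ _ (canon_monom @^-1` (fst @` factorizations A))); last first.
  apply: finite_preimage; last exact: finite_image.
  by move=> t t' _ _ /canon_monom_inj.
move=> t /= tN.
pose B : monom := [cmonom (A v - canon_monom t v)%N | v in X]%M.
have AE v : A v = if v \in X then N else 0%N by rewrite {1}/A cmE fsfun_fun.
have BE v : B v = (A v - canon_monom t v)%N.
  by rewrite {1}/B cmE fsfun_fun; case: ifPn => // /negbTE vX; rewrite AE vX.
exists (canon_monom t, B) => //=; apply: monom_eqP => -[k j].
rewrite cmM BE subnKC // AE; have [v0|v0] := eqVneq (canon_monom t (k, j)) 0%N.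
  by rewrite v0.
rewrite ifT; first exact: leq_trans (le_monom_deg _ _) tN.
rewrite !inE /=; apply/allpairsP; exists (k.-1, j.-1).
rewrite !mem_iota !posS_pred !add0n /= !prednK ?pos_gt0 //.
split=> //; apply: leq_trans tN; first exact: alphabet_le_deg v0.
exact: index_le_deg v0.
Qed.

(** * Coefficients of series *)

Lemma series_coefM (f g : series) a :
  (f * g) a = \sum_(p <- fact_seq a) f p.1 * g p.2.
Proof. exact: series_mulE. Qed.

Lemma series_coef_sum (I : Type) (r : seq I) (P : pred I) (F : I -> series) a :
  (\sum_(i <- r | P i) F i) a = \sum_(i <- r | P i) F i a.
Proof. exact: (big_morph (fun f : series => f a)). Qed.

Lemma series_coefZ (c : rat) (f : series) a : (c *: f) a = c * f a.
Proof. by []. Qed.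

Lemma plam_eq (f g : plam) :
  (forall a, plam_series f a = plam_series g a) -> f = g.
Proof. by move=> fg; apply: val_inj; exact: seriesP fg. Qed.

Lemma plam_coef1 a : plam_series 1 a = (a == mone)%:R.
Proof. by []. Qed.

Lemma plam_coefZ (c : rat) (f : plam) a :
  plam_series (c *: f) a = c * plam_series f a.
Proof. by []. Qed.

Lemma plamM (f g : plam) :
  plam_series (f * g) = plam_series f * plam_series g.
Proof. by []. Qed.

Lemma plam_prod (I : Type) (r : seq I) (P : pred I) (F : I -> plam) :
  plam_series (\prod_(i <- r | P i) F i) =
  \prod_(i <- r | P i) plam_series (F i).
Proof. exact: (big_morph plam_series). Qed.

Lemma plam_sum (I : Type) (r : seq I) (P : pred I) (F : I -> plam) :
  plam_series (\sum_(i <- r | P i) F i) =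
  \sum_(i <- r | P i) plam_series (F i).
Proof. exact: (big_morph plam_series). Qed.

(** * Coefficients of monomial polysymmetric functions *)

Definition alphabet_part (p : pred posint) (a : monom) : monom :=
  [cmonom (if p v.1 then a v else 0%N) | v in finsupp a]%M.

Lemma alphabet_partE p a v : alphabet_part p a v = if p v.1 then a v else 0%N.
Proof.
rewrite /alphabet_part cmE fsfun_fun; case: ifPn => //.
by rewrite -cmE_eq0 => /eqP->; case: ifP.
Qed.

(** If f involves only the alphabet k and g avoids it, then at most one
    factorization of a contributes to the product: a splits into its part in
    the alphabet k and the rest. *)
Lemma coef_mul_disjoint k (f g : series) a :
  (forall b v, f b != 0 -> b v != 0%N -> v.1 = k) ->
  (forall b v, g b != 0 -> b v != 0%N -> v.1 != k) ->
  (f * g) a = f (alphabet_part (pred1 k) a) * g (alphabet_part (predC1 k) a).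
Proof.
move=> fk gk; set a1 := alphabet_part _ a; set a2 := alphabet_part _ a.
have a12 : (a1, a2) \in fact_seq a.
  rewrite mem_fact_seq /=; apply/eqP/monom_eqP => v.
  by rewrite cmM !alphabet_partE /=; case: eqP => //=; rewrite addn0.
rewrite series_coefM (bigD1_seq _ a12) ?fset_uniq //= big1_seq ?addr0 //.
move=> [b c]; rewrite mem_fact_seq /= => /andP[bc /eqP e].
have [->|/fk fb] := eqVneq (f b) 0; first by rewrite mul0r.
have [->|/gk gc] := eqVneq (g c) 0; first by rewrite mulr0.
case/eqP: bc; congr (_, _); apply: monom_eqP => v;
  rewrite alphabet_partE /= -e cmM; case: eqP => vk //=.
- have [->|/gc] := eqVneq (c v) 0%N; first by rewrite addn0.
  by rewrite vk eqxx.
- by have [//|/fb] := eqVneq (b v) 0%N.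
- by have [//|/gc] := eqVneq (c v) 0%N; rewrite vk eqxx.
by have [->//|/fb] := eqVneq (b v) 0%N.
Qed.

Lemma xvar_expE k j n v :
  expcmn (xvar k j) n v = if v == (k, j) :> posint * posint then n else 0%N.
Proof.
rewrite expcmnE ucmE; case: (v =P (k, j)) => [->|ne].
  by case: eqP => //; rewrite muln1.
by case: eqP => [e|]; [case: ne | rewrite muln0].
Qed.

Lemma msym_monomsP (l : intpart) k (a : monom) :
  msym_monoms l k a <->
  (forall v, a v != 0%N -> v.1 = k) /\
  perm_eq (exponents k a) [seq (n : nat) | n : posint <- l].
Proof.
split=> [[j j_inj ->]|[ak /perm_map_lift]].
  set b := \big[_/_]_(i < _) _.
  have bE v : b v = (\sum_(i < size l | v == (k, j i)) tnth (in_tuple l) i)%N.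
    rewrite monom_prodE [RHS]big_mkcond; apply: eq_bigr => i _.
    by rewrite xvar_expE.
  split=> [v|].
    by rewrite bE; apply: contra_neqP => vk; rewrite big1 // => i /eqP /(congr1 fst).
  apply: perm_trans (perm_exponents (s := [seq j i | i <- enum 'I_(size l)]) _ _) _.
  - by rewrite map_inj_uniq ?enum_uniq.
  - move=> i; rewrite bE; apply: contraR => ij; rewrite big1 // => i' /eqP[e].
    by case/mapP: ij; exists i'; rewrite ?mem_enum.
  rewrite -map_comp.
  rewrite (_ : map _ _ = [seq (n : nat) | n : posint <- l]).
    rewrite (@eq_in_filter _ _ predT) ?filter_predT //.
    by move=> n /mapP[p _ ->]; rewrite /= pos_neq0.
  transitivity [seq Defs.nat_of_pos (tnth (in_tuple l) i) | i <- enum 'I_(size l)].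
    apply: eq_map => i /=; rewrite bE (big_pred1 i) // => i' /=.
    by rewrite xpair_eqE eqxx (inj_eq j_inj) eq_sym.
  by rewrite (map_comp Defs.nat_of_pos) map_tnth_enum.
case=> s' s's es'.
have us' : uniq s' by rewrite -(perm_uniq s's) indices_uniq.
have szs : size s' = size l by move/(congr1 size): es'; rewrite !size_map.
have s'l (i : 'I_(size l)) : (i < size s')%N by rewrite szs.
exists (fun i : 'I_(size l) => nth (posS 0) s' i).
  by move=> i i' /eqP; rewrite nth_uniq // => /eqP/val_inj.
apply: monom_eqP => -[k' i]; rewrite monom_prodE.
have ti (i' : 'I_(size l)) :
    Defs.nat_of_pos (tnth (in_tuple l) i') = a (k, nth (posS 0) s' i').
  rewrite (tnth_nth (posS 0)) /= -(nth_map _ 0%N) // es'.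
  by rewrite (nth_map (posS 0)).
have [is'|is'] := boolP ((k' == k) && (i \in s')).
  case/andP: is' => /eqP-> is'.
  have il : (index i s' < size l)%N by rewrite -szs index_mem.
  rewrite (bigD1 (Ordinal il)) //= big1 => [|i' ni'].
    by rewrite addn0 xvar_expE ti /= nth_index // eqxx.
  rewrite xvar_expE xpair_eqE eqxx /=; case: eqP => // e.
  by case/eqP: ni'; apply: val_inj; rewrite /= e index_uniq.
rewrite big1 => [|i' _].
  apply/eqP; move: is'; apply: contraNT => v0.
  by rewrite -(perm_mem s's) mem_indices -(ak _ v0) /= eqxx.
rewrite xvar_expE xpair_eqE; case: andP => // -[/eqP e1 /eqP e2].
by rewrite e1 e2 eqxx mem_nth in is'.
Qed.

Lemma coef_msym (l : intpart) k (a : monom) :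
  msym l k a = (all (fun v : var => v.1 == k) (finsupp a) &&
                perm_eq (exponents k a) [seq (n : nat) | n : posint <- l])%:R.
Proof.
rewrite /msym /=; congr (nat_of_bool _)%:R; apply/idP/andP.
  move=> /set_mem/msym_monomsP[ak ->]; split=> //.
  by apply/allP => v; rewrite -cmE_neq0 => /ak->.
move=> [/allP ak aP]; apply/mem_set/msym_monomsP; split=> // v.
by rewrite cmE_neq0 => /ak/eqP.
Qed.

Lemma coef_prod_msym (K : seq posint) t (a : monom) : uniq K ->
  plam_series (\prod_(k <- K) msym (restr t k) k) a =
  (all (fun v : var => v.1 \in K) (finsupp a) &&
   all (fun k => perm_eq (exponents k a) (rows t k)) K)%:R.
Proof.
elim: K a => [|k K IH] a.
  rewrite big_nil andbT => _; congr (nat_of_bool _)%:R.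
  apply/eqP/allP => [-> v|nv]; first by rewrite mdom1.
  apply: monom_eqP => v; rewrite cm1; apply/eqP; rewrite cmE_eq0.
  by apply/negP => /nv.
rewrite cons_uniq big_cons => /andP[kK uK].
rewrite plamM (@coef_mul_disjoint k); first last.
- move=> b v; rewrite IH // => nz; rewrite cmE_neq0 => bv.
  move: nz; case: allP => [/(_ v bv) vK _|]; last by rewrite eqxx.
  by apply: contraNneq kK => <-.
- move=> b v; rewrite coef_msym => nz; rewrite cmE_neq0 => bv.
  by move: nz; case: allP => [/(_ v bv)/eqP|]; last by rewrite eqxx.
rewrite coef_msym IH // -natrM mulnb; congr (nat_of_bool _)%:R.
have allT : all (fun v : var => v.1 == k) (finsupp (alphabet_part (pred1 k) a)).
  apply/allP => v; rewrite -cmE_neq0 alphabet_partE /=.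
  by case: ifP.
have e1 : perm_eq (exponents k (alphabet_part (pred1 k) a)) (exponents k a).
  by apply: eq_exponents => j; rewrite alphabet_partE /= eqxx.
have e2 k' : k' \in K ->
    perm_eq (exponents k' (alphabet_part (predC1 k) a)) (exponents k' a).
  move=> k'K; apply: eq_exponents => j; rewrite alphabet_partE /=.
  by case: eqP k'K kK => //= -> ->.
have -> : all (fun k' => perm_eq (exponents k' (alphabet_part (predC1 k) a))
    (rows t k')) K = all (fun k' => perm_eq (exponents k' a) (rows t k')) K.
  by apply: eq_in_all => k' /e2 /permPl->.
rewrite allT (permPl e1) andbCA; congr (_ && (_ && _)).
apply/allP/allP => aK v va.
  have [vk|vk] := eqVneq v.1 k; first by rewrite vk mem_head.
  by rewrite inE aK ?orbT // -cmE_neq0 alphabet_partE /= vk cmE_neq0.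
move: va; rewrite -cmE_neq0 alphabet_partE /=; case: (v.1 =P k) => //= vk.
by rewrite cmE_neq0 => /aK; rewrite inE => /orP[/eqP|].
Qed.

Lemma msym_nil k (l : intpart) : l = [::] :> seq posint -> msym l k = 1.
Proof.
move=> l0; apply: plam_eq => a; rewrite coef_msym l0 plam_coef1.
congr (nat_of_bool _)%:R.
apply/andP/eqP => [[/allP ak /perm_nilP e]|->]; last first.
  rewrite mdom1; split; first by apply/allP => v; rewrite in_fset0.
  by rewrite /exponents /indices mdom1.
apply: monom_eqP => v; rewrite cm1; apply/eqP; rewrite cmE_eq0.
apply/negP => va; have /eqP vk := ak v va.
have : v.2 \in indices k a.
  by rewrite mem_indices -vk -surjective_pairing cmE_neq0.
by move/(map_f (fun j => a (k, j))); rewrite -/(exponents k a) e.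
Qed.

(** Each factor involves its own alphabet, so a has coefficient 1 exactly when
    its part in each alphabet k is a monomial of the k-th factor. *)
Lemma coef_mtensor t a : mtensor t a = `[< has_type a t >]%:R.
Proof.
pose K := undup [seq b.1 | b <- t].
have rK k : k \notin K -> rows t k = [::].
  rewrite mem_undup => kK; rewrite /rows /= /mults.
  rewrite (@eq_in_filter _ _ pred0) ?filter_pred0 // => b bt /=.
  by apply: contraNF kK => /eqP<-; exact: map_f.
rewrite /mtensor (fsbigE K) ?undup_uniq //; last first.
  move=> k _ /rK; rewrite /rows => /(congr1 size); rewrite size_map.
  by move=> /size0nil /msym_nil->.
rewrite (eq_bigl xpredT); last by move=> k; rewrite in_setT.
rewrite coef_prod_msym ?undup_uniq //; congr (nat_of_bool _)%:R.
apply/andP/asboolP => [[/allP aK /allP at_K] k|at_].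
  have [/at_K//|kK] := boolP (k \in K).
  rewrite rK // (_ : exponents k a = [::]) //; apply/nilP.
  rewrite /nilp /exponents size_map -leqn0 leqNgt; apply: contra kK => i0.
  have := mem_nth (posS 0) i0; rewrite mem_indices cmE_neq0.
  exact: aK.
split; last by apply/allP => k _; exact: at_.
apply/allP => -[k j] va; apply/negPn/negP => /rK kK.
have := at_ k; rewrite kK => /perm_nilP e.
have : j \in indices k a by rewrite mem_indices cmE_neq0.
by move/(map_f (fun j => a (k, j))); rewrite -/(exponents k a) e.
Qed.

(** * Expansion in the monomial basis *)

(** The functions m_t form a basis: a monomial of type t occurs in m_t only,
    and f takes the same value at all of them.  The sum is finite because f has
    bounded degree. *)
Lemma plam_expansion (f : plam) :
  f = \sum_(t \in [set: blocktype]) plam_series f (canon_monom t) *: mtensor t.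
Proof.
have [[N fN] _] := asboolP _ (plamP f).
pose S := fset_set [set t | (monom_deg (canon_monom t) <= N)%N].
have S0 t : t \notin S -> plam_series f (canon_monom t) = 0.
  move=> tS; apply/eqP; apply: contraNT tS => /fN tN.
  by rewrite in_fset_set ?inE //; exact: finite_types.
rewrite (fsbigTE S) => [|t /S0->]; last by rewrite scale0r.
apply: plam_eq => a; rewrite plam_sum series_coef_sum.
have [t at_] := has_type_exists a.
have fE : plam_series f a = plam_series f (canon_monom t).
  apply: polysym_coef_eq (plamP f) _ => k.
  by rewrite (permPl (at_ k)) perm_sym; exact: canon_monom_has_type.
have tE u : plam_series (plam_series f (canon_monom u) *: mtensor u) a =
    if u == t then plam_series f a else 0.
  rewrite plam_coefZ coef_mtensor; case: eqP => [->|ut].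
    by rewrite fE asboolT // mulr1.
  by rewrite asboolF ?mulr0 // => /has_type_inj-/(_ _ at_).
under eq_bigr do rewrite tE.
rewrite -big_mkcond /=; have [tS|tS] := boolP (t \in S).
  by rewrite -big_filter filter_pred1_uniq ?fset_uniq ?big_seq1.
by rewrite fE S0 // big1_seq.
Qed.

(** * Coefficients of the series P *)

Lemma mmul_cancel (a b c : monom) : mmul a c = mmul b c -> a = b.
Proof.
move=> e; apply: monom_eqP => v; apply: (@addIn (c v)).
by rewrite -!cmM e.
Qed.

Lemma expcmn_inj (e : nat) (a b : monom) : (0 < e)%N ->
  expcmn a e = expcmn b e -> a = b.
Proof.
move=> e0 ab; apply: monom_eqP => v; apply/eqP.
by rewrite -(eqn_pmul2l e0) -!expcmnE ab.
Qed.

Lemma xvar_exp_inj k j k' j' n n' : (0 < n)%N ->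
  expcmn (xvar k j) n = expcmn (xvar k' j') n' -> (k, j) = (k', j').
Proof.
move=> n0 e; have : expcmn (xvar k j) n (k, j) = n by rewrite xvar_expE eqxx.
by rewrite e xvar_expE; case: eqP => // _ n00; rewrite -n00 in n0.
Qed.

Lemma pos_divn_gt0 (d k : posint) : (k %| d)%N -> (0 < d %/ k)%N.
Proof.
move=> kd; rewrite divn_gt0; last exact: pos_gt0.
exact: dvdn_leq (pos_gt0 _) kd.
 Qed.

Lemma coef_powersum n k j : (0 < n)%N ->
  plam_series (powersum n k) (expcmn (xvar k j) n) = 1.
Proof.
move=> n0; rewrite /powersum /=.
rewrite (fsbigTE [fset j]%fset) ?big_seq_fset1 ?eqxx // => i.
rewrite inE => /eqP ij; case: eqP => // /(xvar_exp_inj n0)[e].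
by case: ij.
Qed.

Lemma coef_powersum0 n k a :
  (forall j, a <> expcmn (xvar k j) n) -> plam_series (powersum n k) a = 0.
Proof. by move=> na; rewrite /powersum /= fsbig1 // => j _; case: eqP (na j). Qed.

Definition alphabets_dividing (d : posint) : seq posint :=
  [seq k : posint <- [seq posS i | i <- iota 0 d] | (k %| d)%N].

Lemma alphabets_uniq d : uniq (alphabets_dividing d).
Proof. by rewrite filter_uniq // map_inj_uniq ?iota_uniq //; exact: posS_inj. Qed.

Lemma mem_alphabets (d k : posint) : (k \in alphabets_dividing d) = (k %| d)%N.
Proof.
rewrite mem_filter andb_idr // => kd; apply/mapP; exists k.-1.
  by rewrite mem_iota /= add0n prednK ?pos_gt0 // dvdn_leq ?pos_gt0.
by rewrite posS_pred.
Qed.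

Lemma coef_PdegE (d : posint) a :
  plam_series (Pdeg d) a =
  \sum_(k <- alphabets_dividing d)
     (k : posint)%:R * plam_series (powersum (d %/ k) k) a.
Proof.
rewrite /Pdeg (fsbigE (alphabets_dividing d)) ?alphabets_uniq //.
- rewrite plam_sum series_coef_sum big_seq_cond [RHS]big_seq; apply: eq_bigl => k.
  by rewrite andb_idr // mem_alphabets => kd; apply/mem_set.
- by move=> k; rewrite /= mem_alphabets.
by move=> k /= kd; rewrite mem_alphabets kd.
Qed.

Lemma coef_Pdeg (d k j : posint) : (k %| d)%N ->
  plam_series (Pdeg d) (expcmn (xvar k j) (d %/ k)) = k%:R.
Proof.
move=> kd; have dk0 := pos_divn_gt0 kd.
rewrite coef_PdegE (bigD1_seq k) ?alphabets_uniq ?mem_alphabets //.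
rewrite coef_powersum // mulr1 big1 => [|k' k'k]; first exact: addr0.
rewrite coef_powersum0 ?mulr0 // => j' /(xvar_exp_inj dk0)[e].
by rewrite e eqxx in k'k.
Qed.

Lemma coef_Pdeg0 (d : posint) a :
  (forall k j : posint, (k %| d)%N -> a <> expcmn (xvar k j) (d %/ k)) ->
  plam_series (Pdeg d) a = 0.
Proof.
move=> na; rewrite coef_PdegE big1_seq // => k /andP[_]; rewrite mem_alphabets => kd.
by rewrite coef_powersum0 ?mulr0 // => j; exact: na.
Qed.

(** For b = d^e and v = x_{k,j} this is de/k, the length of the brick of b when
    it lies in component k, and the exponent of v in P_b. *)
Definition brick_len (b : block) (v : var) : nat := (b.1 * b.2 %/ v.1)%N.

Definition brick_monom (b : block) (v : var) : monom :=
  expcmn (xvar v.1 v.2) (brick_len b v).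

Lemma brick_len_gt0 (b : block) (v : var) :
  (v.1 %| b.1)%N -> (0 < brick_len b v)%N.
Proof.
move=> vb; rewrite divn_gt0; last exact: pos_gt0.
apply: (leq_trans (dvdn_leq (pos_gt0 _) vb)).
by apply: leq_pmulr; exact: pos_gt0.
Qed.

Lemma brick_monom_inj (b : block) (v w : var) : (v.1 %| b.1)%N ->
  brick_monom b v = brick_monom b w -> v = w.
Proof.
move=> vb /(xvar_exp_inj (brick_len_gt0 vb)).
by rewrite -!surjective_pairing.
Qed.

Lemma brick_monom_exp (b : block) (v : var) : (v.1 %| b.1)%N ->
  brick_monom b v = expcmn (expcmn (xvar v.1 v.2) (b.1 %/ v.1)) b.2.
Proof.
move=> vb; apply: monom_eqP => w; rewrite !expcmnE mulnA.
by rewrite muln_divA // [(b.2 * _)%N]mulnC.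
Qed.

(** Different terms of P_b have different monomials, so the coefficient of such
    a monomial is the factor k of its term. *)
Lemma coef_Pblock (b : block) (v : var) : (v.1 %| b.1)%N ->
  plam_series (Pblock b) (brick_monom b v) = v.1%:R.
Proof.
move=> vb; rewrite brick_monom_exp // -(coef_Pdeg v.2 vb).
rewrite [LHS]/= (_ : [set _ | _] = [set expcmn (xvar v.1 v.2) (b.1 %/ v.1)]).
  by rewrite fsbig_set1.
apply/seteqP; split=> [c /= /expcmn_inj-> //|c /= -> //].
exact: pos_gt0.
Qed.

Lemma coef_Pblock0 (b : block) (a : monom) :
  (forall v : var, (v.1 %| b.1)%N -> a <> brick_monom b v) ->
  plam_series (Pblock b) a = 0.
Proof.
move=> na; rewrite [LHS]/= fsbig1 // => c /= ca.
apply: coef_Pdeg0 => k j kb ce; apply: (na (k, j)) => //.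
by rewrite brick_monom_exp // -ca ce.
Qed.

(** * Products with monomials *)

Definition monomial (c : monom) : series := Series (fun a => (a == c)%:R).

Lemma coef_mul_monomial (f : series) b c :
  (f * monomial c) (mmul b c) = f b.
Proof.
have bc : (b, c) \in fact_seq (mmul b c) by rewrite mem_fact_seq.
rewrite series_coefM (bigD1_seq _ bc) ?fset_uniq //= eqxx mulr1 big1_seq ?addr0 //.
move=> [b' c']; rewrite mem_fact_seq /= => /andP[ne /eqP e].
case: (c' =P c) => [ec|]; last by rewrite mulr0.
by case/eqP: ne; rewrite ec; congr (_, _); apply: (@mmul_cancel _ _ c); rewrite -e ec.
Qed.

Lemma coef_mul_monomial0 (f : series) c a :
  (forall b, mmul b c <> a) -> (f * monomial c) a = 0.
Proof.
move=> na; rewrite series_coefM big1_seq // => -[b' c'].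
rewrite mem_fact_seq /= => /eqP e.
case: (c' =P c) => [ec|]; last by rewrite mulr0.
by case: (na b'); rewrite -ec.
Qed.

Lemma monomialM c d : monomial c * monomial d = monomial (mmul c d).
Proof.
apply: seriesP => a; have [[b <-]|na] := pselect (exists b, mmul b d = a).
  rewrite coef_mul_monomial /=; congr (nat_of_bool _)%:R.
  by apply/eqP/eqP => [->//|/mmul_cancel].
rewrite coef_mul_monomial0 => [|b ba]; last by apply: na; exists b.
rewrite /=; case: eqP => // e; case: na; exists c.
by rewrite e.
Qed.

Lemma monomial1 : monomial mone = 1.
Proof. by []. Qed.

(** * Truncation to finitely many variables *)

(** Agreement on the monomials in finitely many variables.  It is compatible
    with products because divisors of such a monomial are again of this form,
    and it replaces the infinite sums in P_delta by finite ones. *)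
Definition agree_on (S : {fset var}) (f g : series) : Prop :=
  forall a : monom, (finsupp a `<=` S)%fset -> f a = g a.

Lemma agree_onM S (f f' g g' : series) :
  agree_on S f f' -> agree_on S g g' -> agree_on S (f * g) (f' * g').
Proof.
move=> ff gg a aS; rewrite !series_coefM; apply: eq_big_seq => -[b c].
rewrite mem_fact_seq => /eqP /= e.
have : (finsupp b `|` finsupp c `<=` S)%fset by rewrite -mdomD e.
by rewrite fsubUset => /andP[/ff-> /gg->].
Qed.

Lemma agree_on_prod S (I : Type) (r : seq I) (F G : I -> series) :
  (forall i, agree_on S (F i) (G i)) ->
  agree_on S (\prod_(i <- r) F i) (\prod_(i <- r) G i).
Proof.
by move=> FG; elim/big_ind2: _ => // *; exact: agree_onM.
Qed.

Lemma Pblock_agree (S : {fset var}) (b : block) :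
  agree_on S (Pblock b)
    (\sum_(v : S | ((val v).1 %| b.1)%N)
       ((val v).1 : nat)%:R *: monomial (brick_monom b (val v))).
Proof.
move=> a aS; rewrite series_coef_sum.
have [[v [vb av]]|na] :=
    pselect (exists v : var, (v.1 %| b.1)%N /\ a = brick_monom b v).
  have vS : v \in S.
    apply: (fsubsetP aS); rewrite -cmE_neq0 av xvar_expE.
    by rewrite -surjective_pairing eqxx -lt0n brick_len_gt0.
  rewrite av coef_Pblock // (bigD1 [` vS]%fset) //= eqxx mulr1 big1 ?addr0 //.
  move=> w /andP[wb wv]; case: eqP => [/(brick_monom_inj vb) e|]; last by rewrite mulr0.
  by case/eqP: wv; apply: val_inj; rewrite /= -e.
rewrite coef_Pblock0 => [|v vb av]; last by apply: na; exists v.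
rewrite big1 // => v vb /=; case: eqP => [e|]; last by rewrite mulr0.
by case: na; exists (val v).
Qed.

(** * Coefficients of a monomial function times a product of series P *)

(** The map f picks, in each factor P_{d^e}, the variable of one term; the
    monomial b is the part of a that is left to m_sigma. *)
Definition is_filling (sigma : blocktype) (delta : seq block) (a : monom)
    (f : 'I_(size delta) -> var) : Prop :=
  (forall i, ((f i).1 %| (tnth (in_tuple delta) i).1)%N) /\
  exists2 b : monom, has_type b sigma &
    mmul b (\big[mmul/mone]_(i < size delta)
              brick_monom (tnth (in_tuple delta) i) (f i)) = a.

Lemma coef_mtensor_monomial sigma c a :
  (plam_series (mtensor sigma) * monomial c) a =
  `[< exists2 b, has_type b sigma & mmul b c = a >]%:R.
Proof.
have [[b <-]|na] := pselect (exists b, mmul b c = a).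
  rewrite coef_mul_monomial coef_mtensor; congr (nat_of_bool _)%:R.
  by apply/asboolP/asboolP => [bs|[b' bs /mmul_cancel <-//]]; exists b.
rewrite coef_mul_monomial0 => [|b ba]; last by apply: na; exists b.
by rewrite asboolF // => -[b _ ba]; apply: na; exists b.
Qed.

(** Only variables dividing a can be picked, so the factors of P_delta may be
    truncated to the support of a; distributing the product of finite sums over
    the choices of one term in each factor gives the sum over f. *)
Lemma coef_mtensor_Pseq sigma delta (a : monom) :
  plam_series (mtensor sigma * Pseq delta) a =
  \sum_(f : {ffun 'I_(size delta) -> finsupp a} |
        `[< @is_filling sigma delta a (fun i => val (f i)) >])
    \prod_(i < size delta) ((val (f i)).1 : nat)%:R.
Proof.
set s := size delta; pose d i := tnth (in_tuple delta) i.
(* A variable that may not be picked gets the term 0, so that the sum runs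
   over all of the support. *)
pose F i (v : finsupp a) : series :=
  if ((val v).1 %| (d i).1)%N
  then ((val v).1 : nat)%:R *: monomial (brick_monom (d i) (val v)) else 0.
have PF : agree_on (finsupp a) (Pseq delta) (\prod_(i < s) \sum_v F i v).
  rewrite /Pseq plam_prod big_tnth; apply: agree_on_prod => i.
  by rewrite -big_mkcond; exact: Pblock_agree.
rewrite plamM (agree_onM (f' := plam_series (mtensor sigma)) _ PF) //.
rewrite bigA_distr_bigA mulr_sumr series_coef_sum [RHS]big_mkcond.
apply: eq_bigr => f _.
have [fd|nfd] := pselect (forall i, ((val (f i)).1 %| (d i).1)%N); last first.
  rewrite ifF; last by apply/asboolP => -[].
  have /existsNP[i /negP fi] := nfd.
  rewrite (_ : \prod_(i < s) F i (f i) = 0) ?mulr0 //.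
  by rewrite (bigD1 i) // /F (negPf fi); exact: mul0r.
rewrite (eq_bigr (fun i => ((val (f i)).1 : nat)%:R *:
    monomial (brick_monom (d i) (val (f i))))); last first.
  by move=> i _; rewrite /F fd.
rewrite scaler_prod -scalerAr series_coefZ.
rewrite -(big_morph monomial (fun x y => esym (monomialM x y)) monomial1).
rewrite coef_mtensor_monomial; case: (asboolP (is_filling _ _ _)).
  by case=> _ ex; rewrite asboolT // mulr1.
by move=> nf; rewrite asboolF ?mulr0 // => ex; apply: nf; split.
Qed.

(** * Tilings of a row by intervals *)

(** The left end of the i-th interval when intervals of lengths g 0, g 1, ...
    are laid side by side from 0 on; a length 0 leaves no trace. *)
Definition offset n (g : 'I_n -> nat) (i : nat) : nat :=
  (\sum_(j < n | (j < i)%N) g j)%N.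

Lemma offsetS n (g : 'I_n -> nat) (i : 'I_n) :
  offset g i.+1 = (offset g i + g i)%N.
Proof.
rewrite /offset (bigD1 i) //= addnC; congr addn; apply: eq_bigl => j.
by rewrite ltnS andbC -ltn_neqAle.
Qed.

Lemma leq_offset n (g : 'I_n -> nat) i j :
  (i <= j)%N -> (offset g i <= offset g j)%N.
Proof.
move=> ij; rewrite /offset [leqLHS]big_mkcond [leqRHS]big_mkcond.
apply: leq_sum => k _; case: ifPn => // ki.
by rewrite (leq_trans ki ij).
Qed.

Lemma offset_size n (g : 'I_n -> nat) : offset g n = (\sum_i g i)%N.
Proof. by apply: eq_bigl => i; rewrite ltn_ord. Qed.

Lemma offset_interval n (g : 'I_n -> nat) c : (c < \sum_i g i)%N ->
  exists i : 'I_n, (offset g i <= c < offset g i + g i)%N.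
Proof.
rewrite -offset_size => cn.
suff: forall m, (m <= n)%N -> (c < offset g m)%N ->
  exists i : 'I_n, (offset g i <= c < offset g i + g i)%N by move/(_ n (leqnn n) cn).
elim=> [|m IH]; first by rewrite /offset big_pred0.
move=> mn; have := offsetS g (Ordinal mn) => /= ->.
have [cm _|mc cS] := ltnP c (offset g m); first by apply: IH => //; exact: ltnW.
by exists (Ordinal mn); rewrite /= mc.
Qed.

Lemma offset_interval_inj n (g : 'I_n -> nat) c (i j : 'I_n) :
  (offset g i <= c < offset g i + g i)%N ->
  (offset g j <= c < offset g j + g j)%N -> i = j.
Proof.
move=> /andP[ic ci] /andP[jc cj].
case: (ltngtP i j) => [ij|ji|]; last exact: val_inj.
  have := leq_offset g ij; rewrite offsetS => h.
  by have := leq_trans ci (leq_trans h jc); rewrite ltnn.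
have := leq_offset g ji; rewrite offsetS => h.
by have := leq_trans cj (leq_trans h ic); rewrite ltnn.
Qed.

Lemma sum_interval m p l : (p + l <= m)%N ->
  (\sum_(c < m) (p <= c < p + l)%N)%N = l.
Proof.
suff -> : (\sum_(c < m) (p <= c < p + l) = minn m (p + l) - p)%N by lia.
elim: m => [|m IH]; first by rewrite big_ord0; lia.
by rewrite big_ord_recr /= IH; lia.
Qed.

(** * Brick tilings as arrays of lengths *)

Section Encoding.

Variable s : nat.
Implicit Types (T : {fset brick s}) (x y : brick s)
  (len : var -> 'I_s.+1 -> nat).

(** The variable of the canonical monomial whose exponent is the length of the
    row of x. *)
Definition row_var x : var := (bcomp x, posS (brow x)).

Lemma brick_eq x y : row_var x = row_var y -> bcol x = bcol y ->
  blen x = blen y -> blabel x = blabel y -> x = y.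
Proof. by case: x y => ? ? ? ? ? [? ? ? ? ?] [/= -> ->] -> -> ->. Qed.

(** The bricks of T are given by an array: [len v i] is the length of the brick
    labeled i in the row of v, or 0 if there is none.  Lengths of bricks are
    positive, so a zero entry yields no brick. *)
Definition encodes T len : Prop :=
  forall x, (x \in T) = ((blen x : nat) == len (row_var x) (blabel x)) &&
                        (bcol x == offset (len (row_var x)) (blabel x)).

Definition mk_brick len (v : var) (i : 'I_s.+1) : brick s :=
  Brick v.1 (v.2 : posint).-1 (offset (len v) i) (posS (len v i).-1) i.

Lemma row_var_mk len v i : row_var (mk_brick len v i) = v.
Proof. by rewrite /row_var /= posS_pred -surjective_pairing. Qed.

Lemma mem_mk_brick T len v i : encodes T len -> (0 < len v i)%N ->
  mk_brick len v i \in T.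
Proof. by move=> enc lv; rewrite enc row_var_mk /= prednK // !eqxx. Qed.

Lemma encodes_mk_brick T len x : encodes T len -> x \in T ->
  x = mk_brick len (row_var x) (blabel x).
Proof.
move=> enc; rewrite enc => /andP[/eqP xl /eqP xc].
apply: brick_eq; rewrite ?row_var_mk //=.
by apply: val_inj; rewrite /= -xl prednK // pos_gt0.
Qed.

Lemma encodes_gt0 T len x : encodes T len -> x \in T ->
  (0 < len (row_var x) (blabel x))%N.
Proof. by move=> enc; rewrite enc => /andP[/eqP <- _]; exact: pos_gt0. Qed.

Lemma eq_encodes T T' len len' : encodes T len -> encodes T' len' ->
  (forall v i, len v i = len' v i) -> T = T'.
Proof.
move=> enc enc' ll; apply/fsetP => x; rewrite enc enc' ll.
by congr (_ && (_ == _)); apply: eq_bigr => i _; rewrite ll.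
Qed.

Definition tabloid (S : {fset var}) len : {fset brick s} :=
  [fset x in [seq mk_brick len p.1 p.2
    | p <- [seq (v, i) | v <- S, i <- enum 'I_s.+1] & (0 < len p.1 p.2)%N]]%fset.

Lemma tabloid_encodes (S : {fset var}) len :
  (forall v i, (0 < len v i)%N -> v \in S) -> encodes (tabloid S len) len.
Proof.
move=> lS x; rewrite !inE; apply/mapP/andP => [[[v i]]|[/eqP xl /eqP xc]].
  rewrite mem_filter /= => /andP[lv _] ->.
  by rewrite row_var_mk /= prednK // !eqxx.
exists (row_var x, blabel x) => /=.
  rewrite mem_filter /= -xl pos_gt0 /=; apply/allpairsP.
  exists (row_var x, blabel x); rewrite mem_enum; split=> //.
  by apply: (lS _ (blabel x)); rewrite -xl pos_gt0.
apply: brick_eq; rewrite ?row_var_mk //=.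
by apply: val_inj; rewrite /= -xl prednK // pos_gt0.
Qed.

(** The conditions on a tabloid that do not refer to its content. *)
Definition tiles (t : blocktype) T : Prop :=
  [/\ forall b, b \in T -> brick_boxes b `<=` tensor_diagram t,
      forall x : box, tensor_diagram t x -> exists! b, b \in T /\ brick_boxes b x &
      forall b c, b \in T -> c \in T -> bcomp b = bcomp c -> brow b = brow c ->
        (bcol b < bcol c)%N -> (blabel b < blabel c)%N].

(** Bricks in the order of their labels, each starting where the previous one
    ends, cover the row exactly when their lengths add up to its length. *)
Lemma encodes_tiles (t : blocktype) T len : encodes T len ->
  (forall v, canon_monom t v = \sum_i len v i)%N -> tiles t T.
Proof.
move=> enc lenE.
have rowE k r : rowlen t k r = (\sum_i len (k, posS r) i)%N.
  by rewrite -lenE canon_monomE.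
split.
- move=> b bT [[k r] c] [/= -> ->]; rewrite /tensor_diagram /= rowE.
  move: bT; rewrite enc => /andP[/eqP -> /eqP ->] /andP[_ /leq_trans]; apply.
  by rewrite -offsetS -offset_size leq_offset.
- move=> [[k r] c]; rewrite /tensor_diagram /= rowE.
  move=> /offset_interval[i ci].
  have li : (0 < len (k, posS r) i)%N.
    by case/andP: ci => ic /(leq_ltn_trans ic); rewrite -{1}[offset _ _]addn0 ltn_add2l.
  exists (mk_brick len (k, posS r) i); split.
    split; first exact: mem_mk_brick.
    by split=> //=; rewrite prednK.
  move=> b [bT] [/= bk br bc]; rewrite (encodes_mk_brick enc bT).
  have rb : row_var b = (k, posS r) by rewrite /row_var bk br.
  rewrite rb; congr mk_brick; apply: offset_interval_inj ci _.
  by move: bT; rewrite enc rb => /andP[/eqP <- /eqP <-].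
move=> b c bT cT bck bcr; apply: contraTT; rewrite -!leqNgt => cb.
have rbc : row_var b = row_var c by rewrite /row_var bck bcr.
move: bT cT; rewrite !enc rbc => /andP[_ /eqP->] /andP[_ /eqP->].
exact: leq_offset.
Qed.

(** In a tiling without gaps, a brick starts at the sum of the lengths of the
    bricks on its left, and these are the bricks of smaller label; hence rows,
    labels and lengths determine the positions. *)
Lemma tiles_encodes (t : blocktype) T : tiles t T ->
  exists2 len, encodes T len & forall v, (canon_monom t v = \sum_i len v i)%N.
Proof.
move=> [inT cov inc].
pose len v i := (\sum_(x <- T | (row_var x == v) && (blabel x == i)) blen x)%N.
have own x : (bcol x <= bcol x < bcol x + blen x)%N.
  by rewrite leqnn -{1}[bcol x]addn0 ltn_add2l pos_gt0.
have rowvP x y : row_var x = row_var y -> bcomp x = bcomp y /\ brow x = brow y.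
  by case=> -> ->.
have share x y c : x \in T -> y \in T -> row_var x = row_var y ->
    (bcol x <= c < bcol x + blen x)%N ->
    (bcol y <= c < bcol y + blen y)%N -> x = y.
  move=> xT yT /rowvP[e1 e2] xc yc.
  have bx : brick_boxes x (bcomp x, brow x, c) by [].
  have by_ : brick_boxes y (bcomp x, brow x, c) by [].
  by have [z [_ zu]] := cov _ (inT x xT _ bx); rewrite -(zu x) // -(zu y).
have eqcol x y : x \in T -> y \in T -> row_var x = row_var y ->
    bcol x = bcol y -> x = y.
  by move=> xT yT r e; apply: (share x y (bcol x)) => //; rewrite e own.
have labcol x y : x \in T -> y \in T -> row_var x = row_var y ->
    (blabel x < blabel y)%N = (bcol x < bcol y)%N.
  move=> xT yT r; have [e1 e2] := rowvP _ _ r.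
  case: (ltngtP (bcol x) (bcol y)) => [lt|gt|e].
  - exact: inc lt.
  - by have := inc y x yT xT (esym e1) (esym e2) gt; case: ltngtP.
  by rewrite (eqcol x y) // ltnn.
have eqlab x y : x \in T -> y \in T -> row_var x = row_var y ->
    blabel x = blabel y -> x = y.
  move=> xT yT r e; apply: eqcol => //.
  have := labcol x y xT yT r; have := labcol y x yT xT (esym r).
  by rewrite e !ltnn; case: ltngtP.
have lenE x : x \in T -> len (row_var x) (blabel x) = blen x.
  move=> xT; rewrite /len (big_rem x) //= !eqxx /= big1_seq ?addn0 // => y.
  rewrite mem_rem_uniq ?fset_uniq // inE => /andP[/andP[/eqP r /eqP l] /andP[yx yT]].
  by rewrite (eqlab y x) ?eqxx in yx.
have sum_len v (P : pred 'I_s.+1) :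
    (\sum_(j | P j) len v j =
     \sum_(y <- T | (row_var y == v) && P (blabel y)) blen y)%N.
  rewrite /len (exchange_big_dep (fun y => (row_var y == v) && P (blabel y))) /=.
    apply: eq_bigr => y /andP[rv Py]; rewrite (big_pred1 (blabel y)) // => j.
    by rewrite rv /= eq_sym andb_idl // => /eqP->.
  by move=> j y Pj /andP[-> /eqP->].
(* If no brick crosses column m, the bricks that start before m have total
   length m: count the pairs of a column c < m and a brick covering it. *)
have count v m : (m <= canon_monom t v)%N ->
    (forall y, y \in T -> row_var y = v -> (bcol y < m)%N ->
       (bcol y + blen y <= m)%N) ->
    (\sum_(y <- T | (row_var y == v) && (bcol y < m)) blen y = m)%N.
  case: v => k j mv ym.
  transitivity (\sum_(y <- T | (row_var y == (k, j)) && (bcol y < m)%N)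
      \sum_(c < m) (bcol y <= c < bcol y + blen y)%N)%N.
    rewrite big_seq_cond [RHS]big_seq_cond.
    by apply: eq_bigr => y /and3P[yT /eqP yv yc]; rewrite sum_interval // ym.
  rewrite exchange_big /= -[RHS]card_ord -sum1_card; apply: eq_bigr => c _.
  have dc : tensor_diagram t (k, j.-1, c : nat).
    by rewrite /tensor_diagram /= -canon_monomE (leq_trans _ mv).
  have [x [[xT [/= xk xr xc]] xu]] := cov _ dc.
  have xv : row_var x = (k, j) by rewrite /row_var -xk -xr posS_pred.
  have xm : (bcol x < m)%N by case/andP: xc => /leq_ltn_trans->.
  rewrite (big_rem x) //= xv eqxx xm xc big1_seq // => y.
  rewrite mem_rem_uniq ?fset_uniq // inE => /andP[/andP[/eqP yv _] /andP[yx yT]].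
  case yc: (_ && _) => //; case/eqP: yx; apply: (share y x c) => //.
  by rewrite yv xv.
have enc : encodes T len.
  have fwd x : x \in T -> bcol x = offset (len (row_var x)) (blabel x).
    move=> xT; rewrite /offset sum_len.
    rewrite -[LHS](@count (row_var x)).
    - rewrite big_seq_cond [RHS]big_seq_cond; apply: eq_bigl => y.
      case: (boolP (y \in T)) => //= yT; case: eqP => //= r.
      by rewrite labcol.
    - rewrite canon_monomE /=; apply: ltnW.
      by apply: (inT x xT (bcomp x, brow x, bcol x)); split=> //=; exact: own.
    move=> y yT r yx; rewrite leqNgt; apply/negP => xy.
    have e : y = x.
      by apply: (share y x (bcol x)); rewrite ?own ?(ltnW yx).
    by rewrite e ltnn in yx.
  move=> x; apply/idP/andP => [xT|[/eqP xl /eqP xc]].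
    by rewrite lenE // -fwd.
  have : has (fun y => (row_var y == row_var x) && (blabel y == blabel x)) T.
    apply/negPn/negP => /hasPn none.
    move: xl; rewrite /len big1_seq => [x0|y /andP[yx /none]]; last by rewrite yx.
    by have := pos_gt0 (blen x); rewrite x0.
  case/hasP => y yT /andP[/eqP r /eqP l].
  suff -> : x = y by [].
  apply: brick_eq => //; first by rewrite xc -r -l fwd.
  by apply: val_inj; rewrite /= xl -r -l lenE.
exists len => // v; rewrite sum_len -[LHS](@count v) //.
  rewrite big_seq_cond [RHS]big_seq_cond; apply: eq_bigl => y.
  case: (boolP (y \in T)) => //= yT; case: eqP => //= <-.
  rewrite canon_monomE; apply: (inT y yT (bcomp y, brow y, bcol y)).
  by split=> //=; exact: own.
move=> y yT <- _; rewrite canon_monomE.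
have l0 := pos_gt0 (blen y).
have := inT y yT (bcomp y, brow y, (bcol y + blen y).-1).
rewrite /tensor_diagram /= -ltnS prednK ?addn_gt0 ?l0 ?orbT // ltnS.
apply; split=> //=.
by rewrite -ltnS prednK ?addn_gt0 ?l0 ?orbT // -{1}[bcol y]addn0 ltn_add2l l0 leqnn.
Qed.

(** The bricks labeled 0 correspond to the variables of b. *)
Lemma encodes_exponents T len (b : monom) k : encodes T len ->
  (forall v, b v = len v ord0) ->
  perm_eq [seq (blen x : nat) | x <- T & (bcomp x == k) && (blabel x == ord0)]
          (exponents k b).
Proof.
move=> enc bE; set X := [seq x <- T | _].
have XP x : x \in X -> [/\ x \in T,
    row_var x = (k, posS (brow x)) & blabel x = ord0].
  by rewrite mem_filter => /andP[/andP[/eqP <- /eqP]].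
have -> : [seq (blen x : nat) | x <- X] =
    [seq b (k, j) | j <- [seq posS (brow x) | x <- X]].
  rewrite -map_comp; apply/eq_in_map => x /XP[xT r l] /=.
  by move: xT; rewrite enc r l bE => /andP[/eqP].
 apply/perm_map/uniq_perm.
- rewrite map_inj_in_uniq ?filter_uniq ?fset_uniq // => x y.
  move=> /XP[xT rx lx] /XP[yT ry ly] e.
  by rewrite (encodes_mk_brick enc xT) (encodes_mk_brick enc yT) rx ry lx ly e.
- exact: indices_uniq.
move=> j; rewrite mem_indices bE -lt0n; apply/mapP/idP => [[x /XP[xT r l] ->]|lj].
  by rewrite -r -l (encodes_gt0 enc).
exists (mk_brick len (k, j) ord0); last by rewrite /= posS_pred.
by rewrite mem_filter !eqxx mem_mk_brick.
Qed.

End Encoding.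

(** * Fillings and tabloids *)

Section Fillings.

Variable delta : seq block.
Let s := size delta.
Let d (i : 'I_s) : block := tnth (in_tuple delta) i.
Implicit Types (T : {fset brick s})
  (len : var -> 'I_s.+1 -> nat) (f : 'I_s -> var).

Definition one_brick_per_label T : Prop :=
  forall i : 'I_s, exists b : brick s,
    [/\ forall c, (c \in T) && (blabel c == lift ord0 i) = (c == b),
        (bcomp b %| (d i).1)%N &
        blen b = ((d i).1 * (d i).2 %/ bcomp b)%N :> nat].

Definition placed len f : Prop := forall i v,
  len v (lift ord0 i) = if f i == v then brick_len (d i) v else 0%N.

Lemma placed_brick T len f i : encodes T len -> placed len f ->
  ((f i).1 %| (d i).1)%N ->
  forall c, (c \in T) && (blabel c == lift ord0 i) =
            (c == mk_brick len (f i) (lift ord0 i)).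
Proof.
move=> enc fl fd c; apply/andP/eqP => [[cT /eqP ci]|->]; last first.
  by rewrite eqxx mem_mk_brick // fl eqxx brick_len_gt0.
rewrite {1}(encodes_mk_brick enc cT) ci; congr mk_brick.
have := encodes_gt0 enc cT; rewrite ci fl.
by case: eqP.
Qed.

Lemma placed_one_brick T len f : encodes T len -> placed len f ->
  (forall i, ((f i).1 %| (d i).1)%N) -> one_brick_per_label T.
Proof.
move=> enc fl fd i; exists (mk_brick len (f i) (lift ord0 i)); split=> //=.
  exact: placed_brick.
by rewrite prednK fl eqxx // brick_len_gt0.
Qed.

Lemma one_brick_placed T len i : encodes T len -> one_brick_per_label T ->
  exists v : var, [/\ (v.1 %| (d i).1)%N, (0 < len v (lift ord0 i))%N &
    forall w, len w (lift ord0 i) = if v == w then brick_len (d i) w else 0%N].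
Proof.
move=> enc /(_ i)[b [bP bd bl]].
have /andP[bT /eqP bi] : (b \in T) && (blabel b == lift ord0 i) by rewrite bP.
have lb : len (row_var b) (lift ord0 i) = blen b.
  by move: bT; rewrite enc bi => /andP[/eqP].
exists (row_var b); split=> //; first by rewrite lb pos_gt0.
move=> w; case: eqP => [<-|bw]; first by rewrite lb bl.
apply/eqP; rewrite -leqn0 leqNgt; apply/negP => lw.
case: bw; have /eqP <- : mk_brick len w (lift ord0 i) == b.
  by rewrite -bP mem_mk_brick //= eqxx.
exact: row_var_mk.
Qed.

Lemma nposbricks_placed T len f k : encodes T len -> placed len f ->
  (forall i, ((f i).1 %| (d i).1)%N) ->
  nposbricks T k = #|[pred i | (f i).1 == k]|.
Proof.
move=> enc fl fd; pose B i := mk_brick len (f i) (lift ord0 i).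
have BT i : B i \in T.
  by apply: mem_mk_brick => //; rewrite fl eqxx brick_len_gt0.
have Binj : injective B by move=> i j /(congr1 (@blabel s)) /(@lift_inj _ ord0).
rewrite /nposbricks cardE -(size_map B); apply/perm_size/uniq_perm.
- exact: fset_uniq.
- by rewrite map_inj_uniq ?enum_uniq.
move=> x; rewrite !inE; apply/andP/mapP => /= [[xT /andP[/eqP xk x0]]|].
  have [i xi] : exists i, blabel x = lift ord0 i.
    by case: (unliftP ord0 (blabel x)) x0 => [i|] -> //; exists i.
  have xB : x = B i.
    by apply/eqP; rewrite -(placed_brick enc fl (fd i)) xT xi eqxx.
  by exists i; rewrite // mem_enum inE -xk xB.
case=> i; rewrite mem_enum inE => /eqP ik ->; split; first exact: BT.
by rewrite /= ik eqxx.
Qed.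

Lemma wt_placed T len f : encodes T len -> placed len f ->
  (forall i, ((f i).1 %| (d i).1)%N) ->
  wt T = \prod_(i < s) ((f i).1 : nat)%:R.
Proof.
move=> enc fl fd; pose K := undup [seq (f i).1 | i <- enum 'I_s].
have nE k := nposbricks_placed k enc fl fd.
rewrite /wt (fsbigE K) ?undup_uniq //; last first.
  move=> k _ kK; rewrite nE eq_card0 ?expr0 // => i; rewrite !inE.
  apply: contraNF kK => /eqP <-; rewrite mem_undup; apply/mapP.
  by exists i; rewrite ?mem_enum.
(* Group the labels by the component of their brick. *)
transitivity (\prod_(k <- K) \prod_(i < s | (f i).1 == k) ((f i).1 : nat)%:R : rat).
  rewrite (eq_bigl xpredT); last by move=> k; rewrite in_setT.
  apply: eq_bigr => k _; rewrite nE -prodr_const; apply: eq_big => // i.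
  by rewrite inE => /eqP->.
rewrite (exchange_big_dep predT) //=; apply: eq_bigr => i _.
rewrite -big_filter (eq_filter (a2 := pred1 (f i).1)) => [|k]; last first.
  by rewrite /= eq_sym.
rewrite filter_pred1_uniq ?undup_uniq ?big_seq1 // mem_undup.
by apply/mapP; exists i; rewrite ?mem_enum.
Qed.

Lemma sum_labels (g : 'I_s.+1 -> nat) :
  (\sum_i g i = g ord0 + \sum_i g (lift ord0 i))%N.
Proof. exact: big_ord_recl. Qed.

Lemma coef_filling f v :
  (\big[mmul/mone]_(i < s) brick_monom (d i) (f i)) v =
  (\sum_(i < s) if f i == v then brick_len (d i) v else 0)%N.
Proof.
rewrite monom_prodE; apply: eq_bigr => i _; rewrite xvar_expE.
rewrite -surjective_pairing [v == _]eq_sym.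
by case: eqP => // ->.
Qed.

(** The array of a filling: positive labels are placed by f, and label 0 takes
    what is left of each row. *)
Definition filling_len (a : monom) f (v : var) (i : 'I_s.+1) : nat :=
  if unlift ord0 i is Some j then if f j == v then brick_len (d j) v else 0%N
  else (a v - (\big[mmul/mone]_(i < s) brick_monom (d i) (f i)) v)%N.

Lemma filling_len_placed a f : placed (filling_len a f) f.
Proof. by move=> i v; rewrite /filling_len liftK. Qed.

Lemma filling_len0 (a b : monom) f v :
  mmul b (\big[mmul/mone]_(i < s) brick_monom (d i) (f i)) = a ->
  filling_len a f v ord0 = b v.
Proof. by move=> <-; rewrite /filling_len unlift_none cmM addnK. Qed.

Lemma filling_len_sum (a b : monom) f v :
  mmul b (\big[mmul/mone]_(i < s) brick_monom (d i) (f i)) = a ->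
  (\sum_i filling_len a f v i = a v)%N.
Proof.
move=> ba; rewrite sum_labels (filling_len0 _ ba) -{2}ba cmM coef_filling.
by congr addn; apply: eq_bigr => i _; rewrite filling_len_placed.
Qed.

Lemma filling_encodes (sigma : blocktype) (a : monom) f :
  is_filling sigma a f ->
  encodes (tabloid (finsupp a) (filling_len a f)) (filling_len a f).
Proof.
case=> fd [b _ ba]; apply: tabloid_encodes => v i li.
by rewrite -cmE_neq0 -(filling_len_sum v ba) (bigD1 i) //= -lt0n addn_gt0 li.
Qed.

(** A filling is recovered from its tabloid as the map sending a label to the
    row of its brick; conversely, in any tabloid the lengths in a row add up to
    the length of the row, which forces the brick labeled 0. *)
Lemma filling_bij (tau sigma : blocktype) :
  set_bij
    [set f : {ffun 'I_s -> finsupp (canon_monom tau)} |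
       is_filling sigma (canon_monom tau) (fun i => val (f i))]
    (PTBT tau sigma delta)
    (fun f : {ffun 'I_s -> finsupp (canon_monom tau)} =>
       tabloid (finsupp (canon_monom tau))
                (filling_len (canon_monom tau) (fun i => val (f i)))).
Proof.
set a := canon_monom tau; set S := finsupp a.
have enc (f : {ffun 'I_s -> S}) := @filling_encodes sigma a (fun i => val (f i)).
split.
- move=> f /[dup] fF [fd [b bs ba]]; have e := enc f fF.
  have sumE v : (a v = \sum_i filling_len a (fun i => val (f i)) v i)%N.
    by rewrite (filling_len_sum v ba).
  have [c1 c2 c3] := encodes_tiles e sumE.
  split=> // [k|i]; last first.
    exact: placed_one_brick e (filling_len_placed a _) fd i.
  apply: (perm_map_inj (f := fun n : posint => n : nat)); first exact: val_inj.
  rewrite -map_comp; apply: perm_trans (bs k).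
  exact: encodes_exponents k e (fun v => esym (filling_len0 v ba)).
- move=> f g; rewrite !inE => fF gF fg.
  apply/ffunP => i; apply: val_inj.
  have := placed_brick (enc f fF) (filling_len_placed a _) (fF.1 i).
  rewrite fg.
  have := placed_brick (enc g gF) (filling_len_placed a _) (gF.1 i).
  move=> gP /(_ (mk_brick (filling_len a (fun i => val (g i))) (val (g i)) (lift ord0 i))).
  by rewrite gP eqxx => /esym/eqP /(congr1 (@row_var s)); rewrite !row_var_mk.
move=> T [c1 c2 c3 c4 c5].
have [len e lenE] := tiles_encodes (And3 c1 c2 c3).
have lS v i : (0 < len v i)%N -> v \in S.
  by move=> li; rewrite -cmE_neq0 lenE (bigD1 i) //= -lt0n addn_gt0 li.
have /choice[g gP] i : exists v : S, ((val v).1 %| (d i).1)%N /\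
    forall w, len w (lift ord0 i) = if val v == w then brick_len (d i) w else 0%N.
  have [v [vd vl vP]] := one_brick_placed i e c5.
  by exists [` lS _ _ vl]%fset.
pose f := [ffun i => g i].
have fl : placed len (fun i => val (f i)).
  by move=> i v; rewrite ffunE; case: (gP i).
pose b : monom := [cmonom len v ord0 | v in S]%M.
have bE v : b v = len v ord0.
  rewrite /b cmE fsfun_fun; case: ifPn => // vS; apply/esym/eqP.
  by rewrite -leqn0 leqNgt; apply: contra vS; exact: lS.
have ba : mmul b (\big[mmul/mone]_(i < s) brick_monom (d i) (val (f i))) = a.
  apply: monom_eqP => v; rewrite cmM coef_filling bE lenE sum_labels.
  by congr addn; apply: eq_bigr => i _; rewrite fl.
have fF : is_filling sigma a (fun i => val (f i)).
  split; first by move=> i; rewrite ffunE; case: (gP i).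
  exists b => // k.
  apply: (perm_trans (y := [seq (n : nat) | n : posint <-
    [seq blen x | x <- T & (bcomp x == k) && (blabel x == ord0)]])).
    by rewrite perm_sym -map_comp; exact: encodes_exponents e bE.
  exact: perm_map (c4 k).
exists f => //; apply: (eq_encodes (enc f fF) e) => v i.
case: (unliftP ord0 i) => [j|] ->; first by rewrite fl filling_len_placed.
by rewrite (filling_len0 _ ba) bE.
Qed.

End Fillings.

Theorem theorem54 (sigma : blocktype) (delta : seq block) :
  mtensor sigma * Pseq delta =
  \sum_(tau \in [set: blocktype])
    (\sum_(T \in PTBT tau sigma delta) wt T) *: mtensor tau.
Proof.
rewrite [LHS]plam_expansion; apply: eq_fsbigr => tau _; congr (_ *: _).
rewrite coef_mtensor_Pseq (reindex_fsbig _ _ _ _ (filling_bij delta tau sigma)).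
rewrite [LHS]bigfs ?index_enum_uniq //; last first.
  by move=> f _ /negP[]; exact: mem_index_enum.
rewrite (_ : [set` _] = [set f : {ffun 'I_(size delta) -> finsupp (canon_monom tau)} |
    is_filling sigma (canon_monom tau) (fun i => val (f i))]).
  apply: eq_fsbigr => f; rewrite inE => fF; apply/esym.
  exact: wt_placed (filling_encodes fF) (filling_len_placed _ _) fF.1.
by apply/seteqP; split=> f /= => [/asboolP|fF]; last exact/asboolP.
Qed.
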